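(* Let $q$ be an odd prime power. If $j \in \{1, \dots, q\} \setminus \{(q+1)/2\}$ and $k \in \{1, \dots, q-2\} \setminus \{(q-1)/2\}$, then the sets $\mathcal{S}_j \cup \mathcal{E}_k$, $\mathcal{H}_1 \cup \mathcal{E}_k$ and $\mathcal{S}_j \cup \mathcal{H}_2$ are quasi-Hermitian surfaces of $\mathrm{PG}(3,q^2)$.
   Context: $q$ is an odd prime power and $\xi$ is a fixed primitive element of $\mathbb{F}_{q^2}$. $\mathrm{PG}(3,q^2)$ has homogeneous coordinates $(X_1,X_2,X_3,X_4)$. A quasi-Hermitian surface of $\mathrm{PG}(3,q^2)$ is a set of points having the same intersection numbers with planes as a non-degenerate Hermitian surface, i.e. the set of sizes of its intersections with planes is $\{q^3+1,\; q^3+q^2+1\}$. $\mathcal{H}(3,q^2)$ is the Hermitian surface $X_1^qX_4+X_1X_4^q-X_2^{q+1}-X_3^{q+1}=0$, and $\mathcal{O}=\{(1,t,t^q,t^{q+1}) : t\in\mathbb{F}_{q^2}\}\cup\{(0,0,0,1)\}$ (contained in $\mathcal{H}(3,q^2)$). For $\gamma\in\mathbb{F}_{q^2}$ let $F_\gamma=X_1^q X_4 + X_1 X_4^q - X_2^{q+1} - X_3^{q+1} - \gamma (X_1 X_4 - X_2 X_3)^{\frac{q+1}{2}}$. For $j\in\{1,\dots,q\}\setminus\{(q+1)/2\}$, $\mathcal{S}_j$ is the set of points of $\mathrm{PG}(3,q^2)$ with $F_\gamma=0$, $\gamma=\xi^{j\frac{q-1}{2}}+\xi^{-j\frac{q-1}{2}}$.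 For $k\in\{0,\dots,q-1\}\setminus\{(q-1)/2\}$, $\mathcal{E}_k$ is the set of points with $F_\gamma=0$, $\gamma=\xi^{k\frac{q+1}{2}}+\xi^{-k\frac{q+1}{2}}$. $K\cong \mathrm{PSL}(2,q^2)$ is the group of projectivities of $\mathrm{PG}(3,q^2)$ induced (on column vectors) by the Kronecker products $A^q\otimes A$, $A\in \mathrm{SL}(2,q^2)$, where $A^q$ is $A$ with all entries raised to the $q$-th power. It is known that $K$ has exactly two orbits on the points of $\mathcal{H}(3,q^2)\setminus\mathcal{O}$; $\mathcal{H}_1$ denotes the one of size $q^2(q^2+1)(q-1)/2$ and $\mathcal{H}_2$ the one of size $q^2(q^2+1)(q+1)/2$. *)

(* Defs.v *)
From mathcomp Require Import all_boot all_order all_algebra.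
From mathcomp Require Import mxtens.

Set Implicit Arguments.
Unset Strict Implicit.
Unset Printing Implicit Defensive.

Import GRing.Theory.
Local Open Scope ring_scope.

Section ProjectiveSpace.

Variable F : finFieldType.

(* A point of PG(3, F) is a one-dimensional subspace of F^4, represented by
   its set of vectors (0 included). *)
Definition pt (v : 'cV[F]_4) : {set 'cV[F]_4} := [set a *: v | a : F].

Definition PG : {set {set 'cV[F]_4}} := [set pt v | v : 'cV[F]_4 & v != 0].

(* The points having a representative at which f vanishes; for f homogeneous
   (the only case used) the choice of representative is irrelevant. *)
Definition zero_locus (f : 'cV[F]_4 -> F) : {set {set 'cV[F]_4}} :=
  [set pt v | v : 'cV[F]_4 & (v != 0) && (f v == 0)].

Definition plane (u : 'rV[F]_4) : {set {set 'cV[F]_4}} :=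
  zero_locus (fun v => (u *m v) 0 0).

Definition planes : {set {set {set 'cV[F]_4}}} :=
  [set plane u | u : 'rV[F]_4 & u != 0].

Definition projectivity (M : 'M[F]_4) (P : {set 'cV[F]_4}) :
  {set 'cV[F]_4} := [set M *m v | v in P].

Definition quasi_Hermitian (q : nat) (S : {set {set 'cV[F]_4}}) : Prop :=
  S \subset PG /\
  [seq #|S :&: pi| | pi in planes] =i [:: q ^ 3 + 1; q ^ 3 + q ^ 2 + 1]%N.

End ProjectiveSpace.

Section Surfaces.

Variables (F : finFieldType) (q : nat).

(* The homogeneous coordinate X_i, for 1 <= i <= 4. *)
Definition X (i : nat) (v : 'cV[F]_4) : F := v (inord i.-1) 0.

Definition Hform (v : 'cV[F]_4) : F :=
  X 1 v ^+ q * X 4 v + X 1 v * X 4 v ^+ q - X 2 v ^+ q.+1 - X 3 v ^+ q.+1.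

Definition Fform (gamma : F) (v : 'cV[F]_4) : F :=
  Hform v - gamma * (X 1 v * X 4 v - X 2 v * X 3 v) ^+ (q.+1)./2.

Definition Herm : {set {set 'cV[F]_4}} := zero_locus Hform.

Definition vec4 (a b c d : F) : 'cV[F]_4 :=
  \col_(i < 4) [:: a; b; c; d]`_i.

Definition Oset : {set {set 'cV[F]_4}} :=
  pt (vec4 0 0 0 1) |: [set pt (vec4 1 t (t ^+ q) (t ^+ q.+1)) | t : F].

Definition Sj (xi : F) (j : nat) : {set {set 'cV[F]_4}} :=
  zero_locus (Fform (xi ^+ (j * (q.-1)./2) + xi ^- (j * (q.-1)./2))).

Definition Ek (xi : F) (k : nat) : {set {set 'cV[F]_4}} :=
  zero_locus (Fform (xi ^+ (k * (q.+1)./2) + xi ^- (k * (q.+1)./2))).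

(* A^q is the entrywise (Frobenius) power, not the matrix power; these matrices
   with \det A = 1 induce the group of projectivities K. *)
Definition Kmx (A : 'M[F]_2) : 'M[F]_4 :=
  tensmx (map_mx (fun a => a ^+ q) A) A.

Definition Korbit (P : {set 'cV[F]_4}) : {set {set 'cV[F]_4}} :=
  [set projectivity (Kmx A) P | A : 'M[F]_2 & \det A == 1].

Definition Korbits (S : {set {set 'cV[F]_4}}) : {set {set {set 'cV[F]_4}}} :=
  [set Korbit P | P in S].

(* The K-orbit on Herm minus Oset of the given size (there is exactly one for
   each of the two sizes below); set0 is a dummy default. *)
Definition Horbit_of_size (n : nat) : {set {set 'cV[F]_4}} :=
  odflt set0 [pick B in Korbits (Herm :\: Oset) | #|B| == n].

Definition H1 : {set {set 'cV[F]_4}} :=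
  Horbit_of_size (q ^ 2 * (q ^ 2 + 1) * (q - 1))./2.

Definition H2 : {set {set 'cV[F]_4}} :=
  Horbit_of_size (q ^ 2 * (q ^ 2 + 1) * (q + 1))./2.

End Surfaces.

(* Main.v *)
(* Write a vector X of F^4 as a 2x2 matrix. Let Q = det with polar form B, let
   tau X be the conjugate transpose of X and H(X) = B(X, tau X). Then
   F_gamma = H - gamma Q^((q+1)/2), and K acts by X |-> A^q X A^T. Put
   h_{s,t}(X) = B(s^q t^T, X) and N(x) = x^(q+1). With gamma = w + 1/w, where
   w^(2(q+1)) = 1 for S_j and w^(2(q-1)) = 1 for E_k, membership of X off the
   quadric Q = 0 is read off
   - for S_j from the number of t with (Q/h_{t,t}^2)^((q-1)/2) = w: together with
     the zeros of h_{t,t} they are the isotropic vectors of a nonzero binary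
     Hermitian form whose determinant vanishes exactly when X lies in S_j;
   - for E_k from the number of (s,t) in SL(2) with N(h_{s,t}) = -w Q^((q+1)/2),
     the exceptional t being the eigenvectors, for the eigenvalue -w Q^((q+1)/2),
     of the square of a semilinear map attached to X.
   Both conditions only involve Q/h^2, so summing these identities over the plane
   P^perp reduces to counting {X in P^perp : h = 1, Q = c}, a number that
   depends on c only through whether c = -Q(P)/h(P)^2. The sums that remain are the same
   counts at P, and therefore the plane meets the surface in
   q^3 + 1 + q^2 [P in O + S_{w'} + E_{v'}] points, where w' = +-w, v' = +-v.
   H_1 and H_2 are the two types with w^2 = -1: K is transitive on each, since
   their matrices reduce to diag(z,1), respectively antidiag(z,1). *)

Require Import Defs.
From mathcomp Require Import all_boot all_order all_algebra.
From mathcomp Require Import finfield mxtens ring zify.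

Set Implicit Arguments.
Unset Strict Implicit.
Unset Printing Implicit Defensive.

Import GRing.Theory.
Local Open Scope ring_scope.

(** No type can be treated alone, and this dictates the pairing. Let q = 2m+1 and let z be the
    number of nonzero t with h_{t,t}(P) = 0. Counting vectors, z enters the intersections of the
    plane P^perp with a set of type S, of type E and with O with the coefficients m, -(m+1) and 1,
    so it disappears exactly when one set of each type is joined to O. The remaining constants add
    up to (q^2-1)(q^3+1), because m(q^2-1) + (m+1)(q^2+1) = q^3+1. The contribution of P in O has
    another source. If P is a multiple of s^q t^T, the slice of P^perp where h_{s,t} = 1 is empty,
    whereas for the other P with h_{s,t}(P) = 0 it contains q^2 vectors with each value of Q. The
    correction sums to a multiple of the indicator of O. The signs in w' = (-1)^m w and v' =
    (-1)^(m+1) v come from the minus sign of c = -Q(P)/h(P)^2, raised to the powers m and m+1 that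
    define the two kinds of class. All counts are natural numbers, so identities with negative terms
    are stated with those terms on the other side. *)

Lemma sum_bool_card (T : finType) (P : pred T) :
  (\sum_x (P x : nat) = #|[set x | P x]|)%N.
Proof. by rewrite -sum1dep_card [RHS]big_mkcond; apply: eq_bigr => x _; case: (P x). Qed.

(** * Power equations in a finite field *)

Section FiniteField.

Variable F : finFieldType.

Lemma card_expf_le (a : nat) (z : F) : (0 < a)%N -> (#|[set x : F | x ^+ a == z]| <= a)%N.
Proof.
move=> a_gt0; pose p : {poly F} := 'X^a - z%:P.
have sp : size p = a.+1 by rewrite size_XnsubC.
have p0 : p != 0 by rewrite -size_poly_eq0 sp.
rewrite cardE -ltnS -sp; apply: max_poly_roots => //; last exact: enum_uniq.
by apply/allP => x; rewrite mem_enum inE rootE !hornerE => /eqP->; rewrite subrr.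
Qed.

(** A pigeonhole argument replaces cyclicity: the a b nonzero elements are mapped by the a-th power
    into at most b roots of unity, and each fibre has at most a elements, so every fibre is full. *)
Lemma sum_expf_eq (a b : nat) (z : F) :
  (a * b = #|F|.-1)%N -> z ^+ b = 1 -> (\sum_x (x ^+ a == z : nat) = a)%N.
Proof.
move=> ab zb.
have ab_gt0 : (0 < a * b)%N by rewrite ab -subn1 subn_gt0 finNzRing_gt1.
have /andP[a0 b0] : (0 < a)%N && (0 < b)%N by rewrite -muln_gt0.
pose U := [set y : F | y ^+ b == 1].
have cU : (#|U| <= b)%N by apply: card_expf_le.
have tot : (\sum_(y in U) #|[set x : F | x ^+ a == y]| = a * b)%N.
  have -> : (a * b = \sum_(x : F | x != 0%R) 1)%N.
    by rewrite sum1_card ab (cardD1 0) inE /=; apply: eq_card => x; rewrite !inE andbT.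
  symmetry; rewrite (partition_big (fun x : F => x ^+ a) (mem U)); last first.
    move=> x x0; rewrite /= !inE -exprM ab.
    apply/eqP/(mulfI x0); rewrite mulr1 -exprS prednK ?expf_card //.
    exact: ltnW (finNzRing_gt1 F).
  apply: eq_bigr => y yb; rewrite sum1dep_card.
  apply: eq_card => x; rewrite !inE ?andbT; rewrite andbC; case: (x ^+ a =P y) => //= xy.
  apply/eqP => x0; move: yb.
  by rewrite /= inE -xy x0 -exprM expr0n gtn_eqF // eq_sym oner_eq0.
rewrite sum_bool_card; apply/eqP; rewrite eqn_leq card_expf_le //= leqNgt.
apply/negP => lt.
have zU : z \in U by rewrite inE zb.
have : (\sum_(y in U) #|[set x : F | x ^+ a == y]| < \sum_(y in U) a)%N.
  rewrite (bigD1 z) //= [X in (_ < X)%N](bigD1 z) //= -addSn leq_add //.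
  by apply: leq_sum => y _; apply: card_expf_le.
by rewrite tot sum_nat_const mulnC ltn_mul2r a0 /= ltnNge cU.
Qed.

Lemma expf_solvable (a b : nat) (z : F) :
  (a * b = #|F|.-1)%N -> z ^+ b = 1 -> exists x, x ^+ a = z.
Proof.
move=> ab zb; have := sum_expf_eq ab zb.
have ab_gt0 : (0 < a * b)%N by rewrite ab -subn1 subn_gt0 finNzRing_gt1.
have a0 : (0 < a)%N by case: (a) ab_gt0.
case: (pickP (fun x : F => x ^+ a == z)) => [x /eqP xa|no]; first by exists x.
by rewrite big1 => [h|x _]; [rewrite -h in a0 | rewrite no].
Qed.

End FiniteField.

(** * Counting over the field with q^2 elements *)

Definition frob (F : finFieldType) (q : nat) (x : F) : F := x ^+ q.

Definition frob2 (F : finFieldType) (q : nat) (s : F * F) : F * F := (frob q s.1, frob q s.2).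

Definition det2 (F : finFieldType) (s t : F * F) : F := s.1 * t.2 - s.2 * t.1.

(* The coordinates (x1, x2, x3, x4) are stored as ((x1, x2), (x3, x4)), the rows of
   a 2x2 matrix. *)
Definition quad (F : finFieldType) (X : F * F * (F * F)) : F := X.1.1 * X.2.2 - X.1.2 * X.2.1.

Definition polar (F : finFieldType) (P X : F * F * (F * F)) : F :=
  P.1.1 * X.2.2 + P.2.2 * X.1.1 - P.1.2 * X.2.1 - P.2.1 * X.1.2.

Definition herm (F : finFieldType) (q : nat) (X : F * F * (F * F)) : F :=
  frob q X.1.1 * X.2.2 + X.1.1 * frob q X.2.2
  - X.1.2 * frob q X.1.2 - X.2.1 * frob q X.2.1.

(* [ev s t X] is [polar (s *m t^T) X]. *)
Definition ev (F : finFieldType) (s t : F * F) (X : F * F * (F * F)) : F :=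
  s.1 * t.1 * X.2.2 + s.2 * t.2 * X.1.1 - s.1 * t.2 * X.2.1 - s.2 * t.1 * X.1.2.

Definition scale4 (F : finFieldType) (a : F) (X : F * F * (F * F)) : F * F * (F * F) :=
  ((a * X.1.1, a * X.1.2), (a * X.2.1, a * X.2.2)).

Local Notation "'#[' x | P ]" := (\sum_x nat_of_bool P%R)%N (at level 0, x name, P at level 200).

Section Surface.

Variables (F : finFieldType) (m : nat).
Local Notation q := (m.*2.+1).
Local Notation n := (q ^ 2)%N.
Local Notation r := (4 * (m * m.+1))%N.
Hypothesis cardF : #|F| = n.
Hypothesis frobD : forall x y : F, (x + y) ^+ q = x ^+ q + y ^+ q.

Local Notation T2 := (F * F)%type.
Local Notation T4 := (F * F * (F * F))%type.
Local Notation bar := (@frob F q).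
Local Notation N x := (x * bar x).
Local Notation h s t X := (ev (frob2 q s) t X).
Implicit Types (x y z a b c w : F) (s t : T2) (X Y P : T4).

Lemma card_pred : #|F|.-1 = r.
Proof. by rewrite cardF; nia. Qed.

Lemma m_gt0 : (0 < m)%N.
Proof. by have := finNzRing_gt1 F; rewrite cardF; case: (m). Qed.

Lemma barD x y : bar (x + y) = bar x + bar y.
Proof. exact: frobD. Qed.

Lemma barM x y : bar (x * y) = bar x * bar y.
Proof. exact: exprMn. Qed.

Lemma bar0 : bar 0 = 0.
Proof. exact: expr0n. Qed.

Lemma bar1 : bar 1 = 1.
Proof. exact: expr1n. Qed.

Lemma barN x : bar (- x) = - bar x.
Proof. by apply/eqP; rewrite -addr_eq0 -barD addNr bar0. Qed.

Lemma barV x : bar x^-1 = (bar x)^-1.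
Proof. exact: exprVn. Qed.

Lemma barX x k : bar (x ^+ k) = bar x ^+ k.
Proof. by rewrite /frob exprAC. Qed.

Lemma barK x : bar (bar x) = x.
Proof. by rewrite /frob -exprM mulnn -cardF expf_card. Qed.

Lemma bar_eq0 x : (bar x == 0) = (x == 0).
Proof. by rewrite expf_eq0. Qed.

Lemma normE x : N x = x ^+ q.+1.
Proof. by rewrite exprS. Qed.

Lemma norm_eq0 x : (N x == 0) = (x == 0).
Proof. by rewrite mulf_eq0 bar_eq0 orbb. Qed.

Lemma bar_norm x : bar (N x) = N x.
Proof. by rewrite barM barK mulrC. Qed.

Lemma bar_fixed x : x != 0 -> (bar x == x) = (x ^+ m.*2 == 1).
Proof. by move=> x0; rewrite /frob exprS -[X in _ == X]mulr1 (inj_eq (mulfI x0)). Qed.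

(** Since 2 divides q^2-1, the equation x^2 = 1 has two solutions; in characteristic 2 it would only
    have the solution 1. *)
Lemma two_neq0 : 2%:R != 0 :> F.
Proof.
apply/eqP => two0.
have /(sum_expf_eq (a := 2) (b := 2 * (m * m.+1)) (z := 1)) : (2 * (2 * (m * m.+1)) = #|F|.-1)%N.
  by rewrite card_pred; lia.
rewrite expr1n => /(_ erefl); rewrite (bigD1 1) //= expr1n eqxx big1 // => x x1.
apply/eqP; rewrite eqb0; apply: contra x1 => /eqP x1.
have : (x - 1) ^+ 2 = 0 by rewrite sqrrB1 x1 -mulr_natl two0 mul0r subr0; exact: two0.
by move/eqP; rewrite expf_eq0 subr_eq0.
Qed.

Lemma sum_norm_eq a : bar a = a -> a != 0 -> #[x | N x == a] = q.+1.
Proof.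
move=> aa a0; have := @sum_expf_eq F q.+1 m.*2 a.
rewrite card_pred => <-; first by apply: eq_bigr => x _; rewrite normE.
  by lia.
by apply/eqP; rewrite -bar_fixed ?aa.
Qed.

Lemma sum_norm_eq0 : #[x | N x == 0] = 1%N.
Proof.
rewrite (bigD1 0) //= mul0r eqxx big1 // => x x0.
by rewrite norm_eq0 (negPf x0).
Qed.

(** Multiplication by such a d turns differences of conjugates into elements fixed by conjugation;
    this makes the coefficients of a Hermitian form out of skew expressions. *)
Lemma exists_skew : exists2 d : F, d != 0 & bar d = - d.
Proof.
have [||d d1] := @expf_solvable F m.*2 q.+1 (-1); first by rewrite card_pred; lia.
  by rewrite -signr_odd /= odd_double.
have d0 : d != 0.
  apply: contra_eq_neq d1 => ->; rewrite expr0n double_eq0 gtn_eqF ?m_gt0 //.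
  by rewrite eq_sym oppr_eq0 oner_eq0.
by exists d => //; rewrite /frob exprS d1 mulrN1.
Qed.

Lemma sum_trace_eq b : bar b = b -> #[x | x + bar x == b] = q.
Proof.
move=> bb; have two0 := two_neq0.
rewrite (reindex_inj (addrI (b / 2%:R))) /=.
have -> : #[x | b / 2%:R + x + bar (b / 2%:R + x) == b] = #[x | x + bar x == 0].
  apply: eq_bigr => x _; congr nat_of_bool.
  rewrite barD barM barV bb (_ : bar 2%:R = 2%:R); last by rewrite barD bar1.
  rewrite -subr_eq0; congr (_ == 0); field; exact: two0.
(* After the shift by b/2 the trace is 0; besides 0 itself the solutions are the q - 1 roots of
   [x ^+ m.*2 = -1]. *)
rewrite (bigD1 0) //= add0r bar0 eqxx.
have := @sum_expf_eq F m.*2 q.+1 (-1).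
rewrite card_pred (bigD1 0) //= expr0n double_eq0 gtn_eqF ?m_gt0 //.
rewrite eq_sym oppr_eq0 oner_eq0 add0n => E; rewrite add1n; congr _.+1.
apply: etrans (E _ _); first (apply: eq_bigr => x x0).
- rewrite addr_eq0 eq_sym eqr_oppLR /frob exprS -[X in - X]mulr1 -mulrN.
  by rewrite (inj_eq (mulfI x0)).
- by lia.
- by rewrite -signr_odd /= odd_double.
Qed.

(** Pairs with nonzero second coordinate are written as (x y, y): for a homogeneous condition the
    factor y drops out and only the affine coordinate x remains. *)
Lemma sum_pair_nz (f : T2 -> nat) :
  (\sum_(t : T2 | t != 0%R) f t
   = \sum_(x | x != 0%R) f (x, 0%R) + \sum_(y | y != 0%R) \sum_x f (x * y, y)%R)%N.
Proof.
rewrite big_mkcond (eq_bigr (fun t => if (t.1, t.2) != 0 then f (t.1, t.2) else 0%N)); last by case.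
rewrite -(pair_bigA _ (fun x y => if (x, y) != 0 then f (x, y) else 0%N)) /=.
rewrite exchange_big (bigD1 0) //=; congr (_ + _)%N.
  by rewrite -big_mkcond; apply: eq_bigl => x; rewrite xpair_eqE eqxx andbT.
apply: eq_bigr => y y0; rewrite (reindex_inj (mulIf y0)) /=.
by apply: eq_bigr => x _; rewrite xpair_eqE (negPf y0) andbF.
Qed.


Lemma sum_nz_const k : (\sum_(x : F | x != 0%R) k = r * k)%N.
Proof.
rewrite sum_nat_const -card_pred (cardD1 0 F) inE /=; congr (_ * _)%N.
by apply: eq_card => x; rewrite !inE andbT.
Qed.

Lemma sum_affine_eq a b : a != 0 -> #[x | a * x + b == 0] = 1%N.
Proof.
move=> a0; rewrite (bigD1 (- b / a)) //= mulrC divfK // addNr eqxx big1 // => x xb.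
apply/eqP; rewrite eqb0; apply: contra xb => /eqP E.
by rewrite eq_sym -subr_eq0 -(inj_eq (mulfI a0)) mulr0 mulrBr mulrC divfK // -opprD addrC E oppr0.
Qed.

(** A nonzero binary Hermitian form has one isotropic point when it is singular and q+1 otherwise,
    and a point carries r nonzero vectors. The affine equation becomes a norm equation for a nonzero
    and a trace equation for a = 0. *)
Lemma sum_isotropic a b c :
  bar a = a -> bar b = b -> [|| a != 0, b != 0 | c != 0] ->
  (\sum_(t : T2 | t != 0%R)
     (a * N t.1 + b * N t.2 + c * t.1 * bar t.2 + bar c * bar t.1 * t.2 == 0)%R
   = if (a * b == N c)%R then r else r * q.+1)%N.
Proof.
move=> aa bb nz; rewrite sum_pair_nz /=.
pose K := #[x | a * N x + b + c * x + bar c * bar x == 0].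
have -> : (\sum_(x : F | x != 0%R)
    (a * N x + b * (0 * bar 0) + c * x * bar 0 + bar c * bar x * 0 == 0)%R
    = r * (a == 0)%R)%N.
  rewrite -sum_nz_const; apply: eq_bigr => x x0.
  by rewrite !(bar0, mulr0, addr0, mul0r) mulf_eq0 norm_eq0 (negPf x0) orbF.
have -> : (\sum_(y : F | y != 0%R) \sum_x
    (a * N (x * y) + b * N y + c * (x * y) * bar y + bar c * bar (x * y) * y == 0)%R
    = r * K)%N.
  rewrite -sum_nz_const; apply: eq_bigr => y y0; apply: eq_bigr => x _; congr nat_of_bool.
  rewrite (_ : _ + _ = N y * (a * N x + b + c * x + bar c * bar x)); last by rewrite !barM; ring.
  by rewrite mulf_eq0 norm_eq0 (negPf y0).
rewrite -mulnDr.
suff -> : ((a == 0%R) + K = if (a * b == N c)%R then 1 else q.+1)%N by case: ifP; rewrite ?muln1.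
have [a0|a0] := eqVneq a 0; last first.
  pose d := N c - a * b.
  (* Completing the square: multiply by a and substitute a x + [bar c] for x. *)
  have -> : K = #[x | N x == d].
    rewrite [RHS](reindex_inj (addIr (bar c))) [RHS](reindex_inj (mulfI a0)).
    apply: eq_bigr => x _; congr nat_of_bool.
    rewrite -[RHS]subr_eq0 -[LHS](inj_eq (mulfI a0)) mulr0; congr (_ == 0).
    by rewrite /d barD barM barK aa; ring.
  rewrite add0n -[a * b == _]subr_eq0 -oppr_eq0 opprB -/d.
  have [->|d0] := eqVneq d 0; first exact: sum_norm_eq0.
  by apply: sum_norm_eq => //; rewrite /d barD barN bar_norm barM aa bb.
rewrite {}/K a0 mul0r eq_sym norm_eq0 add1n; have [c0|c0] := eqVneq c 0.
  congr _.+1; rewrite big1 // => x _; move: nz.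
  by rewrite a0 c0 eqxx orbF /= => b0; rewrite bar0 !mul0r add0r !addr0 (negPf b0).
congr _.+1; apply: etrans (@sum_trace_eq (- b) _); last by rewrite barN bb.
rewrite [RHS](reindex_inj (mulfI c0)); apply: eq_bigr => x _; congr nat_of_bool.
by rewrite -[RHS]subr_eq0 opprK barM; congr (_ == 0); ring.
Qed.

(** * Pointwise characterisations of the surfaces *)

(* [(q ^ 2 - 1) / 2], so that [x ^+ halfexp] is the quadratic character. *)
Definition halfexp := (2 * (m * m.+1))%N.

(** Complementary factors of q^2-1, in the form asked for by [expf_solvable] and [sum_expf_eq]: they
    recognise m-th powers, (m+1)-th powers and squares by their orders. *)
Lemma m_mul : (m * (2 * q.+1) = #|F|.-1)%N.
Proof. by rewrite card_pred; lia. Qed.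

Lemma mS_mul : (m.+1 * (2 * m.*2) = #|F|.-1)%N.
Proof. by rewrite card_pred; lia. Qed.

Lemma halfexp_mul : (2 * halfexp = #|F|.-1)%N.
Proof. by rewrite card_pred /halfexp; lia. Qed.

Lemma expf1_neq0 x k : (0 < k)%N -> x ^+ k = 1 -> x != 0.
Proof.
by move=> k0; apply: contra_eq_neq => ->; rewrite expr0n gtn_eqF // eq_sym oner_eq0.
Qed.

Lemma bar_coset c : bar c = c * (c ^+ m) ^+ 2.
Proof. by rewrite /frob -exprM -exprS muln2. Qed.

Lemma bar_evh t X : bar (h t t X) =
  N t.1 * bar X.2.2 + N t.2 * bar X.1.1 - t.1 * bar t.2 * bar X.2.1 - bar t.1 * t.2 * bar X.1.2.
Proof. by rewrite /ev /= !(barD, barN, barM, barK); ring. Qed.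

(* Choose rho with [(quad X / rho ^+ 2) ^+ m = w]: the condition on t says that
   [h t t X / rho] is fixed by Frobenius, i.e. that the Hermitian form with
   coefficients a, b, e below vanishes at t. *)
Lemma sum_S_pointwise w X :
  w ^+ (2 * q.+1) = 1 -> w ^+ 2 != 1 -> quad X ^+ halfexp = w ^+ q.+1 ->
  (\sum_(t : T2 | t != 0%R) ((h t t X != 0) && ((quad X / h t t X ^+ 2) ^+ m == w))%R
   + \sum_(t : T2 | t != 0%R) (h t t X == 0)%R
   + q * r * (herm q X == (w + w^-1) * quad X ^+ m.+1)%R = r * q.+1)%N.
Proof.
move=> w1 w2 QX.
have w0 : w != 0 by apply: expf1_neq0 w1.
have [c cw] : exists c : F, c ^+ m = w by apply: expf_solvable m_mul w1.
have c0 : c != 0.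
  by apply: contra_neq w0 => c0; rewrite -cw c0 expr0n gtn_eqF ?m_gt0.
(* The quotient is a square because [c ^+ halfexp = w ^+ q.+1] is also the quadratic character of
   [quad X]. *)
have [rho rhoE] : exists rho : F, rho ^+ 2 = quad X / c.
  apply: expf_solvable halfexp_mul _.
  rewrite exprMn QX exprVn (_ : halfexp = m * q.+1)%N; last by rewrite /halfexp; lia.
  by rewrite exprM cw divff // expf_neq0.
have {rhoE} QE : quad X = c * rho ^+ 2 by rewrite rhoE mulrC divfK.
have rho0 : rho != 0.
  apply: contra_eq_neq QX => rho0.
  rewrite QE rho0 expr0n mulr0 expr0n gtn_eqF ?muln_gt0 ?m_gt0 //=.
  by rewrite eq_sym expf_neq0.
have [d d0 dbar] := exists_skew.
pose a := d * (rho * bar X.2.2 - bar rho * X.2.2).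
pose b := d * (rho * bar X.1.1 - bar rho * X.1.1).
pose e := d * (bar rho * X.1.2 - rho * bar X.2.1).
have ea : bar a = a by rewrite /a !(barD, barN, barM, barK) dbar; ring.
have eb : bar b = b by rewrite /b !(barD, barN, barM, barK) dbar; ring.
have ee : bar e = d * (bar rho * X.2.1 - rho * bar X.1.2).
  by rewrite /e !(barD, barN, barM, barK) dbar; ring.
have bQ : bar (quad X) = c * w ^+ 2 * bar rho ^+ 2.
  by rewrite QE barM barX bar_coset cw.
have bQ' : bar (quad X) = bar X.1.1 * bar X.2.2 - bar X.1.2 * bar X.2.1.
  by rewrite /quad barD barN !barM.
(* If the form vanished, [rho ^+ 2 * bar (quad X)] would be fixed by conjugation; with
   [quad X = c * rho ^+ 2] and [bar c = c * w ^+ 2] this gives w^2 = 1. *)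
have nz : [|| a != 0, b != 0 | e != 0].
  apply: contraT; rewrite !negb_or !negbK => /and3P[/eqP a0 /eqP b0 /eqP e0].
  have e0' : bar e = 0 by rewrite e0 bar0.
  have : d ^+ 2 * (rho ^+ 2 * bar (quad X) - bar rho ^+ 2 * quad X) = 0.
    rewrite bQ' /quad; transitivity (a * b + d * (bar rho * X.1.1 * a + bar rho * X.2.2 * b)
       - (e * bar e - d * (bar rho * X.1.2 * bar e + bar rho * X.2.1 * e))).
      by rewrite ee /a /b /e; ring.
    by rewrite a0 b0 e0' e0; ring.
  rewrite bQ QE => /eqP; rewrite (_ : _ - _ = c * rho ^+ 2 * bar rho ^+ 2 * (w ^+ 2 - 1)); last by ring.
  rewrite !mulf_eq0 !expf_eq0 /= ?bar_eq0 (negPf d0) (negPf c0) (negPf rho0) /= subr_eq0.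
  by rewrite (negPf w2).
have E t : (((h t t X != 0) && ((quad X / h t t X ^+ 2) ^+ m == w))%R + (h t t X == 0)%R
   = (a * N t.1 + b * N t.2 + e * t.1 * bar t.2 + bar e * bar t.1 * t.2 == 0)%R)%N.
  rewrite [in RHS](_ : _ + _ = d * (rho * bar (h t t X) - bar rho * h t t X)); last first.
    by rewrite bar_evh ee /a /b /e /ev /=; ring.
  rewrite mulf_eq0 (negPf d0) /=; move: (h t t X) => y.
  have [->|y0] := eqVneq y 0; first by rewrite bar0 !mulr0 subrr eqxx.
  rewrite addn0 /= subr_eq0; congr nat_of_bool.
  have -> : (quad X / y ^+ 2) ^+ m = w * (rho / y) ^+ m.*2.
    by rewrite QE -mulrA -expr_div_n exprMn cw -mul2n exprM.
  rewrite -[X in _ == X]mulr1 (inj_eq (mulfI w0)) -bar_fixed ?mulf_neq0 ?invr_eq0 //.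
  by rewrite barM barV -[RHS]eqr_div ?bar_eq0 //;
    rewrite eqr_div ?bar_eq0 // eq_sym mulrC [X in _ == X]mulrC.
rewrite -big_split /= (eq_bigr _ (fun t _ => E t)) sum_isotropic //.
(* The determinant is nonzero up to the factor [rho * bar rho * c * (1 + w ^+ 2) - herm q X], and
   [rho * bar rho * c * w] equals [quad X ^+ m.+1]. *)
have -> : (a * b == N e) = (herm q X == (w + w^-1) * quad X ^+ m.+1).
  rewrite -subr_eq0 (_ : a * b - _ = d ^+ 2 * (rho * bar rho)
    * (rho * bar rho * c * (1 + w ^+ 2) - herm q X)); last first.
    transitivity (d ^+ 2 * (rho ^+ 2 * bar (quad X) + bar rho ^+ 2 * quad X - rho * bar rho * herm q X)).
      by rewrite bQ' ee /a /b /e /herm /quad; ring.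
    by rewrite bQ QE; ring.
  rewrite !mulf_eq0 !expf_eq0 /= ?bar_eq0 (negPf d0) (negPf rho0) /= subr_eq0 eq_sym.
  congr (_ == _); rewrite QE exprMn [c ^+ _]exprS cw -[(rho ^+ 2) ^+ _]exprM.
  have -> : rho ^+ (2 * m.+1) = rho * bar rho by rewrite normE; congr (_ ^+ _); lia.
  by field.
by case: ifP => _; lia.
Qed.

(** * Pairs of determinant one and the semilinear map of a matrix *)

Definition lin2 s a t : T2 := (s.1 + a * t.1, s.2 + a * t.2).

Definition base2 t : T2 := if t.2 == 0 then (0, - t.1^-1) else (t.2^-1, 0).

Lemma nz2 t : (t != 0) = (t.1 != 0) || (t.2 != 0).
Proof. by case: t => x y; rewrite xpair_eqE negb_and. Qed.

Lemma det2_base t : t != 0 -> det2 (base2 t) t = 1.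
Proof.
rewrite nz2 /det2 /base2; have [->|t0] := eqVneq t.2 0; last first.
  by move=> _; rewrite /= mul0r subr0 mulVf.
by rewrite orbF /= => t0; rewrite mul0r sub0r mulNr opprK mulVf.
Qed.

(** The vectors s with [det2 s t = 1] form the affine line through [base2 t] in the direction of t;
    the parameter is recovered as [det2 (base2 t) s] by Cramer's rule. *)
Lemma sum_det1 t (f : T2 -> nat) : t != 0 ->
  (\sum_(s | (det2 s t == 1)%R) f s = \sum_a f (lin2 (base2 t) a t))%N.
Proof.
move=> /det2_base; set b := base2 t => bt.
rewrite (reindex_onto (fun a => lin2 b a t) (fun s => det2 b s)) /=.
  apply: eq_bigl => a; apply/andP; split; apply/eqP.
    by transitivity (det2 b t); rewrite // /det2 /lin2 /=; ring.
  by transitivity (a * det2 b t); [rewrite /det2 /lin2 /=; ring | rewrite bt mulr1].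
move=> s /eqP st.
have e1 : b.1 * det2 s t + det2 b s * t.1 = s.1 * det2 b t by rewrite /det2; ring.
have e2 : b.2 * det2 s t + det2 b s * t.2 = s.2 * det2 b t by rewrite /det2; ring.
by move: e1 e2; rewrite st bt !mulr1 /lin2 => -> ->; case: (s).
Qed.

Lemma evh_lin2 s a t X : h (lin2 s a t) t X = h s t X + bar a * h t t X.
Proof. by rewrite /ev /lin2 /frob2 /= !(barD, barM); ring. Qed.

Lemma det2_eq0 s t : t != 0 -> det2 t s = 0 -> exists a, s = (a * t.1, a * t.2).
Proof.
case: s => s1 s2; rewrite nz2 /det2 /=; have [t1|t1 _] := eqVneq t.1 0 => /=.
  move=> t2 /eqP; rewrite t1 mul0r sub0r oppr_eq0 mulf_eq0 (negPf t2) /= => /eqP->.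
  by exists (s2 / t.2); rewrite mulr0 divfK.
move=> /eqP; rewrite subr_eq0 => /eqP E; exists (s1 / t.1); rewrite divfK //.
by congr (_, _); apply: (mulfI t1); rewrite E; field.
Qed.

Lemma sum_ker2 (a b c d : F) :
  [|| a != 0, b != 0, c != 0 | d != 0] -> a * d = b * c ->
  (\sum_(t : T2 | t != 0%R) ((a * t.1 + b * t.2 == 0) && (c * t.1 + d * t.2 == 0))%R = r)%N.
Proof.
move=> nz E; rewrite sum_pair_nz /=.
transitivity (r * ((a == 0) && (c == 0))%R + r * #[x | (a * x + b == 0) && (c * x + d == 0)])%N.
  congr (_ + _)%N; rewrite -sum_nz_const; apply: eq_bigr => y y0.
    by rewrite !mulr0 !addr0 !mulf_eq0 (negPf y0) !orbF.
  apply: eq_bigr => x _; congr nat_of_bool.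
  by rewrite !mulrA -!mulrDl !mulf_eq0 (negPf y0) !orbF.
rewrite -mulnDr -[RHS]muln1; congr (_ * _)%N.
have [a0|a0] := eqVneq a 0; last first.
  rewrite add0n -(sum_affine_eq b a0); apply: eq_bigr => x _; congr nat_of_bool.
  case: eqP => //= abx; apply/eqP/(mulfI a0); rewrite mulr0 mulrDr E mulrCA.
  by rewrite (_ : a * x = - b) ?mulrN ?[c * b]mulrC ?addNr //; apply/eqP; rewrite -addr_eq0 abx.
have [c0|c0] := eqVneq c 0; last first.
  rewrite add0n -(sum_affine_eq d c0); apply: eq_bigr => x _; congr nat_of_bool.
  rewrite a0 mul0r add0r; move/eqP: E; rewrite a0 mul0r eq_sym mulf_eq0 (negPf c0) orbF => ->.
  by [].
rewrite /= big1 // => x _; move: nz; rewrite a0 c0 !mul0r !add0r eqxx /= => /orP[]/negPf-> //.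
by rewrite andbF.
Qed.

(* With K(t) = (kt1 t, kt2 t), the matrix (a11, a12; a21, a22) represents the square
   of the semilinear map [t |-> conj (K t)]; when its eigenvalue k is simple and lies
   in F_q, that map preserves the eigenline, i.e. K t is a multiple rho of conj t,
   and then [h t t X = 0] and [N rho = k]. *)
Section Eigen.

Variables (k : F) (X : T4).
Hypothesis barn_k : bar k = k.

Let kt1 t := t.1 * X.1.2 - t.2 * X.1.1.
Let kt2 t := t.1 * X.2.2 - t.2 * X.2.1.
Let a11 := X.1.2 * bar X.1.2 - X.2.2 * bar X.1.1.
Let a12 := X.2.1 * bar X.1.1 - X.1.1 * bar X.1.2.
Let a21 := X.1.2 * bar X.2.2 - X.2.2 * bar X.2.1.
Let a22 := X.2.1 * bar X.2.1 - X.1.1 * bar X.2.2.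
Let ker t := ((a11 - k) * t.1 + a12 * t.2 == 0) && (a21 * t.1 + (a22 - k) * t.2 == 0).

(** This is the characteristic polynomial at k: the matrix has trace [- herm q X] and determinant
    [N (quad X)]. *)
Lemma eigen_det : (a11 - k) * (a22 - k) - a12 * a21 = k ^+ 2 + k * herm q X + N (quad X).
Proof. by rewrite /a11 /a12 /a21 /a22 /quad /herm barD barN !barM; ring. Qed.

(** Otherwise the matrix would be the scalar k and its determinant k^2. *)
Lemma eigen_nz : k ^+ 2 != N (quad X) ->
  [|| a11 - k != 0, a12 != 0, a21 != 0 | a22 - k != 0].
Proof.
apply: contraNT; rewrite !negb_or !negbK => /and4P[/eqP z1 /eqP z2 /eqP z3 /eqP z4].
have : (a11 - k) * (a22 - k) - a12 * a21 + k * (a11 - k) + k * (a22 - k) = N (quad X) - k ^+ 2.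
  by rewrite eigen_det /a11 /a22 /herm; ring.
by rewrite z1 z2 z3 z4 => /esym/eqP; rewrite !(mulr0, addr0, subr0) subr_eq0 eq_sym.
Qed.

Lemma bar_det2_base t : t != 0 ->
  bar (base2 t).1 * bar t.2 - bar (base2 t).2 * bar t.1 = 1.
Proof. by move=> /det2_base; rewrite /det2 -!barM -barN -barD => ->; rewrite bar1. Qed.

(** [h s t X] is the determinant of conj s and K t. Hence [h t t X = 0] means K t = rho conj t, with
    rho read off at s = [base2 t], and the square of the semilinear map multiplies t by N rho. *)
Lemma evh_eigen_ker t : t != 0 ->
  (h t t X == 0) && (N (h (base2 t) t X) == k) -> ker t.
Proof.
move=> t0; have := bar_det2_base t0; set b := base2 t => bbt.
move=> /andP[/eqP h0 /eqP hk]; apply/andP.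
  set rho := h b t X in hk.
  have g1 : kt1 t = rho * bar t.1.
    rewrite -[LHS]mulr1 -bbt /rho /kt1 /kt2 /=.
    transitivity (bar t.1 * h b t X - bar b.1 * h t t X); last by rewrite h0; ring.
    by rewrite /ev /=; ring.
  have g2 : kt2 t = rho * bar t.2.
    rewrite -[LHS]mulr1 -bbt /rho /kt1 /kt2 /=.
    transitivity (bar t.2 * h b t X - bar b.2 * h t t X); last by rewrite h0; ring.
    by rewrite /ev /=; ring.
  have bk1 : bar t.1 * bar X.1.2 - bar t.2 * bar X.1.1 = bar rho * t.1.
    by rewrite -!barM -barN -barD -/(kt1 t) g1 barM barK.
  have bk2 : bar t.1 * bar X.2.2 - bar t.2 * bar X.2.1 = bar rho * t.2.
    by rewrite -!barM -barN -barD -/(kt2 t) g2 barM barK.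
  split; apply/eqP.
    transitivity (kt1 t * bar X.1.2 - kt2 t * bar X.1.1 - k * t.1); first by rewrite /a11 /a12 /kt1 /kt2 /=; ring.
    rewrite g1 g2 -hk.
    transitivity (rho * (bar t.1 * bar X.1.2 - bar t.2 * bar X.1.1 - bar rho * t.1)); first by ring.
    by rewrite bk1; ring.
  transitivity (kt1 t * bar X.2.2 - kt2 t * bar X.2.1 - k * t.2); first by rewrite /a21 /a22 /kt1 /kt2 /=; ring.
  rewrite g1 g2 -hk.
  transitivity (rho * (bar t.1 * bar X.2.2 - bar t.2 * bar X.2.1 - bar rho * t.2)); first by ring.
  by rewrite bk2; ring.
Qed.

Lemma ker_evh_eigen t : k ^+ 2 != N (quad X) -> t != 0 ->
  ker t -> (h t t X == 0) && (N (h (base2 t) t X) == k).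
Proof.
move=> kQ t0; have bbt := bar_det2_base t0; move=> /andP[/eqP k1 /eqP k2].
have M1 : kt1 t * bar X.1.2 - kt2 t * bar X.1.1 = k * t.1.
  by apply/eqP; rewrite -subr_eq0 -k1; apply/eqP; rewrite /a11 /a12 /kt1 /kt2 /=; ring.
have M2 : kt1 t * bar X.2.2 - kt2 t * bar X.2.1 = k * t.2.
  by apply/eqP; rewrite -subr_eq0 -k2; apply/eqP; rewrite /a21 /a22 /kt1 /kt2 /=; ring.
(* The image of t under the semilinear map. As k is fixed by conjugation, t' lies in the same
   eigenspace, which is a line since the matrix minus k is not zero; thus t' = mu t, which yields
   both [h t t X = 0] and N mu = k. *)
pose t' : T2 := (bar (kt1 t), bar (kt2 t)).
have N1 : kt1 t' = k * bar t.1.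
  by rewrite -[k]barn_k -barM -M1 barD barN !barM !barK.
have N2 : kt2 t' = k * bar t.2.
  by rewrite -[k]barn_k -barM -M2 barD barN !barM !barK.
have K1 : (a11 - k) * t'.1 + a12 * t'.2 = 0.
  transitivity (kt1 t' * bar X.1.2 - kt2 t' * bar X.1.1 - k * t'.1); first by rewrite /a11 /a12 /kt1 /kt2 /=; ring.
  by rewrite N1 N2 /t' /= barD barN !barM; ring.
have K2 : a21 * t'.1 + (a22 - k) * t'.2 = 0.
  transitivity (kt1 t' * bar X.2.2 - kt2 t' * bar X.2.1 - k * t'.2); first by rewrite /a21 /a22 /kt1 /kt2 /=; ring.
  by rewrite N1 N2 /t' /= barD barN !barM; ring.
have D : det2 t t' = 0.
  have D1 x y : x * t.1 + y * t.2 = 0 -> x * t'.1 + y * t'.2 = 0 -> (x != 0) || (y != 0) -> det2 t t' = 0.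
    move=> e1 e2 /orP[x0|y0]; [apply: (mulfI x0) | apply: (mulfI y0)]; rewrite mulr0 /det2.
      transitivity ((x * t.1 + y * t.2) * t'.2 - (x * t'.1 + y * t'.2) * t.2); first by ring.
      by rewrite e1 e2; ring.
    transitivity ((x * t'.1 + y * t'.2) * t.1 - (x * t.1 + y * t.2) * t'.1); first by ring.
    by rewrite e1 e2; ring.
  have [n1|] := boolP ((a11 - k != 0) || (a12 != 0)); first exact: D1 k1 K1 n1.
  rewrite negb_or !negbK => /andP[/eqP z1 /eqP z2]; apply: D1 k2 K2 _.
  by move: (eigen_nz kQ); rewrite z1 z2 eqxx.
have [mu muE] := det2_eq0 t0 D.
have g1 : kt1 t = bar mu * bar t.1 by rewrite -barM -[X in _ = bar X]/(mu * t.1, mu * t.2).1 -muE barK.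
have g2 : kt2 t = bar mu * bar t.2 by rewrite -barM -[X in _ = bar X]/(mu * t.1, mu * t.2).2 -muE barK.
have hs s : h s t X = bar mu * (bar s.1 * bar t.2 - bar s.2 * bar t.1).
  transitivity (bar s.1 * kt2 t - bar s.2 * kt1 t); first by rewrite /ev /kt1 /kt2 /=; ring.
  by rewrite g1 g2; ring.
rewrite !hs bbt mulr1 barK (_ : _ - _ = 0) ?mulr0 ?eqxx /=; last by ring.
have bk1 : bar t.1 * bar X.1.2 - bar t.2 * bar X.1.1 = mu * t.1.
  by rewrite -!barM -barN -barD -/(kt1 t) g1 barM !barK.
have bk2 : bar t.1 * bar X.2.2 - bar t.2 * bar X.2.1 = mu * t.2.
  by rewrite -!barM -barN -barD -/(kt2 t) g2 barM !barK.
move: t0; rewrite nz2 => /orP[t1|t2]; apply/eqP.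
  apply: (mulIf t1); rewrite -M1 g1 g2.
  by transitivity (bar mu * (mu * t.1)); [ring | rewrite -bk1; ring].
apply: (mulIf t2); rewrite -M2 g1 g2.
by transitivity (bar mu * (mu * t.2)); [ring | rewrite -bk2; ring].
Qed.

Lemma sum_eigen : k ^+ 2 != N (quad X) ->
  (\sum_(t : T2 | t != 0%R) ((h t t X == 0) && (N (h (base2 t) t X) == k))%R
   = r * (k ^+ 2 + k * herm q X + N (quad X) == 0)%R)%N.
Proof.
move=> kQ; rewrite -eigen_det subr_eq0.
have [E|E] := eqVneq ((a11 - k) * (a22 - k)) (a12 * a21).
  rewrite muln1 -[RHS](sum_ker2 (eigen_nz kQ) E); apply: eq_bigr => t t0; congr nat_of_bool.
  by apply/idP/idP; [exact: evh_eigen_ker | exact: ker_evh_eigen].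
rewrite muln0 big1 // => t t0; apply/eqP; rewrite eqb0.
apply: contra E => /(evh_eigen_ker t0) /andP[/eqP k1 /eqP k2]; rewrite -subr_eq0.
move: t0; rewrite nz2 => /orP[t1|t2]; apply/eqP.
  apply: (mulIf t1); rewrite mul0r.
  transitivity ((a22 - k) * ((a11 - k) * t.1 + a12 * t.2)
                - a12 * (a21 * t.1 + (a22 - k) * t.2)); first by ring.
  by rewrite k1 k2; ring.
apply: (mulIf t2); rewrite mul0r.
transitivity ((a11 - k) * (a21 * t.1 + (a22 - k) * t.2)
              - a21 * ((a11 - k) * t.1 + a12 * t.2)); first by ring.
by rewrite k1 k2; ring.
Qed.

Lemma eigen_exists : k ^+ 2 != N (quad X) -> k ^+ 2 + k * herm q X + N (quad X) = 0 ->
  exists2 t : T2, t != 0 &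
    (kt1 t * bar X.1.2 - kt2 t * bar X.1.1 = k * t.1) /\
    (kt1 t * bar X.2.2 - kt2 t * bar X.2.1 = k * t.2).
Proof.
move=> kQ; rewrite -eigen_det => /eqP; rewrite subr_eq0 => /eqP /(sum_ker2 (eigen_nz kQ)) E.
have [t /andP[t0 /andP[/eqP k1 /eqP k2]]|none] := pickP (fun t : T2 => (t != 0) && ker t).
  exists t => //; split; apply/eqP; rewrite -subr_eq0.
    by rewrite -k1; apply/eqP; rewrite /a11 /a12 /kt1 /kt2 /=; ring.
  by rewrite -k2; apply/eqP; rewrite /a21 /a22 /kt1 /kt2 /=; ring.
have : (0 < r)%N by rewrite !muln_gt0 m_gt0.
by rewrite -E big1 // => t t0; have := none t; rewrite t0 /ker /= => ->.
Qed.

End Eigen.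

Lemma sum_evh_line k s0 t X : bar k = k -> k != 0 ->
  (\sum_a (N (h (lin2 s0 a t) t X) == k)%R
   = q.+1 * (h t t X != 0)%R + n * ((h t t X == 0) && (N (h s0 t X) == k))%R)%N.
Proof.
move=> bk k0; under eq_bigr do rewrite evh_lin2.
have [h0|h0] := eqVneq (h t t X) 0.
  under eq_bigr do rewrite h0 mulr0 addr0.
  by rewrite sum_nat_const cardF /= muln0.
rewrite muln1 muln0 addn0 -(sum_norm_eq bk k0) [RHS](reindex_inj (addrI (h s0 t X))) /=.
rewrite [RHS](reindex_inj (mulIf h0)) /= [RHS](reindex_inj (can_inj barK)) //=.
Qed.

Lemma half_norm x : x ^+ m.+1 ^+ 2 = N x.
Proof. by rewrite normE -exprM; congr (_ ^+ _); clear; lia. Qed.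

(* For fixed t, s runs over an affine line on which [h s t X] is bijective unless
   [h t t X = 0], where it is constant. *)
Lemma sum_E_pointwise w X :
  w ^+ (2 * m.*2) = 1 -> w ^+ 2 != 1 -> quad X ^+ halfexp = w ^+ m.*2 ->
  (\sum_(t : T2 | t != 0%R) \sum_(s | (det2 s t == 1)%R) (N (h s t X) == - (w * quad X ^+ m.+1))%R
   = q.+1 * \sum_(t : T2 | t != 0%R) (h t t X != 0)%R
     + n * r * (herm q X == (w + w^-1) * quad X ^+ m.+1)%R)%N.
Proof.
move=> w1 w2 QX.
have w0 : w != 0 by apply: expf1_neq0 w1; rewrite muln_gt0 double_gt0 m_gt0.
have Q0 : quad X != 0.
  apply: contra_eq_neq QX => ->; rewrite expr0n gtn_eqF ?muln_gt0 ?m_gt0 // eq_sym.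
  by rewrite expf_neq0.
set g := quad X ^+ m.+1; have g0 : g != 0 by rewrite expf_neq0.
set k := - (w * g); have k0 : k != 0 by rewrite oppr_eq0 mulf_neq0.
have bk : bar k = k.
  apply/eqP; rewrite bar_fixed // exprNn exprMn -signr_odd odd_double mul1r.
  rewrite -exprM (_ : m.+1 * m.*2 = halfexp)%N; last by rewrite /halfexp; lia.
  by rewrite QX -exprMn -expr2 -exprM w1.
have gQ : g ^+ 2 = N (quad X) by exact: half_norm.
(* The product of the eigenvalues is g^2, so the partner of - w g is - g/w, and the trace condition
   reads herm = (w + 1/w) g. The two are distinct because w^2 is not 1, which is [kQ]. *)
have kE : (k ^+ 2 + k * herm q X + N (quad X) == 0) = (herm q X == (w + w^-1) * g).
  rewrite -gQ (_ : _ + _ = k * (herm q X - (w + w^-1) * g)); last by rewrite /k; field.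
  by rewrite mulf_eq0 (negPf k0) subr_eq0.
have kQ : k ^+ 2 != N (quad X).
  rewrite -gQ sqrrN exprMn -subr_eq0 -[X in _ - X]mul1r -mulrBl mulf_eq0 subr_eq0.
  by rewrite (negPf w2) expf_eq0 (negPf g0) andbF.
rewrite -kE -mulnA -sum_eigen // !big_distrr /= -big_split; apply: eq_bigr => t t0 /=.
by rewrite sum_det1 // sum_evh_line.
Qed.

(** * Affine quadrics in planes *)

(* [lnul t P && rnul s P] says that P is a scalar multiple of [s *m t^T] (or 0). *)
Definition lnul t P := (t.1 * P.2.2 - t.2 * P.2.1 == 0) && (t.2 * P.1.1 - t.1 * P.1.2 == 0).

Definition rnul s P := (s.1 * P.2.2 - s.2 * P.1.2 == 0) && (s.2 * P.1.1 - s.1 * P.2.1 == 0).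

Lemma lnulE s t P : s != 0 -> lnul t P = (ev s t P == 0) && (ev (base2 s) t P == 0).
Proof.
move=> s0; have := det2_base s0; rewrite /det2; set b := base2 s => bs.
pose x := t.1 * P.2.2 - t.2 * P.2.1; pose y := t.2 * P.1.1 - t.1 * P.1.2.
have ex s' : ev s' t P = s'.1 * x + s'.2 * y by rewrite /ev /x /y; ring.
rewrite !ex /lnul -/x -/y; apply/andP/andP => -[/eqP e1 /eqP e2].
  by rewrite e1 e2 !mulr0 addr0.
split; apply/eqP.
  transitivity ((b.1 * s.2 - b.2 * s.1) * x); first by rewrite bs mul1r.
  by transitivity ((b.1 * x + b.2 * y) * s.2 - (s.1 * x + s.2 * y) * b.2); [ring | rewrite e1 e2; ring].
transitivity ((b.1 * s.2 - b.2 * s.1) * y); first by rewrite bs mul1r.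
by transitivity ((s.1 * x + s.2 * y) * b.1 - (b.1 * x + b.2 * y) * s.1); [ring | rewrite e1 e2; ring].
Qed.

Definition swap4 X : T4 := ((X.1.1, X.2.1), (X.1.2, X.2.2)).

Lemma ev_swap s t X : ev t s (swap4 X) = ev s t X.
Proof. by rewrite /ev /=; ring. Qed.

Lemma rnulE s t P : t != 0 -> rnul s P = (ev s t P == 0) && (ev s (base2 t) P == 0).
Proof. by move=> t0; rewrite -!(ev_swap _ _ P) -(lnulE s (swap4 P) t0). Qed.

(** A change of coordinates that turns [ev s t] into the last coordinate; it is an isometry of
    [quad] when both pairs have determinant 1. *)
Definition frame (s' s t' t : T2) X : T4 := ((ev s' t' X, ev s' t X), (ev s t' X, ev s t X)).

Section Frame.

Variables s' s t' t : T2.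
Hypotheses (ds : det2 s' s = 1) (dt : det2 t' t = 1).
Local Notation g := (frame s' s t' t).

Lemma quad_frame X : quad (g X) = quad X.
Proof.
rewrite -[RHS]mulr1 -{1}ds -[RHS]mulr1 -{1}dt.
by rewrite /quad /frame /ev /det2 /=; ring.
Qed.

Lemma polar_frame P X : polar (g P) (g X) = polar P X.
Proof.
rewrite -[RHS]mulr1 -{1}ds -[RHS]mulr1 -{1}dt.
by rewrite /polar /frame /ev /det2 /=; ring.
Qed.

Lemma frame_inj : injective g.
Proof.
pose f (Y : T4) : T4 :=
  ((s.1 * t.1 * Y.1.1 - s.1 * t'.1 * Y.1.2 - s'.1 * t.1 * Y.2.1 + s'.1 * t'.1 * Y.2.2,
    s.1 * t.2 * Y.1.1 - s.1 * t'.2 * Y.1.2 - s'.1 * t.2 * Y.2.1 + s'.1 * t'.2 * Y.2.2),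
   (s.2 * t.1 * Y.1.1 - s.2 * t'.1 * Y.1.2 - s'.2 * t.1 * Y.2.1 + s'.2 * t'.1 * Y.2.2,
    s.2 * t.2 * Y.1.1 - s.2 * t'.2 * Y.1.2 - s'.2 * t.2 * Y.2.1 + s'.2 * t'.2 * Y.2.2)).
apply: (@can_inj _ _ _ f) => -[[x1 x2] [x3 x4]].
have e y : y = y * det2 s' s * det2 t' t by rewrite ds dt !mulr1.
by rewrite [in RHS](e x1) [in RHS](e x2) [in RHS](e x3) [in RHS](e x4) /f /frame /ev /det2 /=;
  congr ((_, _), (_, _)); ring.
Qed.

Lemma frame_eq0 X : (g X == 0) = (X == 0).
Proof.
have g0 : g 0 = 0 by rewrite /frame /ev /= !(mulr0, subr0, addr0).
by rewrite -{1}g0 (inj_eq frame_inj).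
Qed.

End Frame.

Lemma sum_mul_eq a : (\sum_x \sum_y (x * y == a)%R = r + n * (a == 0)%R)%N.
Proof.
rewrite (bigD1 0) //= addnC; congr (_ + _)%N.
  rewrite -[RHS]muln1 -sum_nz_const; apply: eq_bigr => x x0.
  rewrite -(sum_affine_eq (- a) x0); apply: eq_bigr => y _.
  by rewrite subr_eq0.
by under eq_bigr do rewrite mul0r eq_sym; rewrite sum_nat_const cardF.
Qed.

Lemma sum_lin_eq a b c : (a != 0) || (b != 0) -> (\sum_x \sum_y (a * x + b * y == c)%R = n)%N.
Proof.
move=> ab; have [b0|b0] := eqVneq b 0; last first.
  transitivity (\sum_(x : F) 1)%N; last by rewrite sum_nat_const muln1 cardF.
  apply: eq_bigr => x _; rewrite -(sum_affine_eq (a * x - c) b0); apply: eq_bigr => y _.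
  by rewrite -subr_eq0 addrA [b * y + _]addrC.
have a0 : a != 0 by move: ab; rewrite b0 eqxx orbF.
rewrite exchange_big; transitivity (\sum_(x : F) 1)%N; last by rewrite sum_nat_const muln1 cardF.
apply: eq_bigr => y _; rewrite -(sum_affine_eq (- c) a0); apply: eq_bigr => x _.
by rewrite subr_eq0 b0 mul0r addr0.
Qed.

Lemma sum_quadruple (f : T4 -> nat) :
  (\sum_X f X = \sum_y \sum_z \sum_x \sum_w f ((x, y), (z, w)))%N.
Proof.
rewrite (eq_bigr (fun X => f ((X.1.1, X.1.2), (X.2.1, X.2.2)))); last by move=> [[? ?] [? ?]].
rewrite -(pair_bigA _ (fun x1 x2 : T2 => f ((x1.1, x1.2), (x2.1, x2.2)))) /=.
rewrite -(pair_bigA _ (fun x y => \sum_(x2 : T2) f ((x, y), (x2.1, x2.2))))%N /= exchange_big /=.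
apply: eq_bigr => y _; rewrite [RHS]exchange_big; apply: eq_bigr => x _.
by rewrite -(pair_bigA _ (fun z w => f ((x, y), (z, w)))).
Qed.

(** In the frame of s and t the slice is x4 = 1, so x1 = c + x2 x3 is determined by the value c of
    [quad], and orthogonality to P = (p1, p2, p3, p4) becomes an equation in x2, x3. For nonzero p4
    it is the hyperbola (p4 x2 - p2)(p4 x3 - p3) = p2 p3 - p1 p4 - p4^2 c, which degenerates to two
    lines, with n more solutions, exactly for c = - quad P / p4^2. For p4 = 0 it is linear. *)
Lemma sum_affine_quadric (C : pred F) s t P : s != 0 -> t != 0 ->
  (\sum_X ((polar P X == 0) && ((ev s t X == 1) && C (quad X)))%R
   = if (ev s t P != 0)%R then #[c | C c] * r + n * C (- quad P / ev s t P ^+ 2)%R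
     else if lnul t P && rnul s P then #[c | C c] * (n * n) * (P == 0)%R else #[c | C c] * n)%N.
Proof.
move=> s0 t0; have ds := det2_base s0; have dt := det2_base t0.
rewrite (lnulE t P s0) (rnulE s P t0).
transitivity (\sum_X ((polar (frame (base2 s) s (base2 t) t P) X == 0)
   && ((X.2.2 == 1) && C (quad X)))%R)%N.
  rewrite [RHS](reindex_inj (frame_inj ds dt)); apply: eq_bigr => X _.
  by rewrite polar_frame // quad_frame.
rewrite -(quad_frame ds dt P) -(frame_eq0 ds dt P).
rewrite -[ev s t P]/((frame (base2 s) s (base2 t) t P).2.2).
rewrite -[ev s (base2 t) P]/((frame (base2 s) s (base2 t) t P).2.1).
rewrite -[ev (base2 s) t P]/((frame (base2 s) s (base2 t) t P).1.2).
move: (frame _ _ _ _ P) => [[p1 p2] [p3 p4]] /=.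
rewrite sum_quadruple /=.
transitivity (\sum_c C c * \sum_y \sum_z (p4 * c + p4 * y * z + p1 - p2 * z - p3 * y == 0)%R)%N.
  under [RHS]eq_bigr do rewrite big_distrr /=.
  rewrite [RHS]exchange_big; apply: eq_bigr => y _.
  under [RHS]eq_bigr do rewrite big_distrr /=.
  rewrite [RHS]exchange_big; apply: eq_bigr => z _.
  rewrite [RHS](reindex_inj (addIr (- (y * z)))); apply: eq_bigr => x _.
  rewrite (bigD1 1) //= big1 ?addn0 => [|w w1]; last by rewrite (negPf w1) /= andbF.
  rewrite eqxx /= mulnb andbC /polar /quad /= mulr1; congr ((_ && (_ == _)) : nat); ring.
have [p40|p40] := eqVneq p4 0 => /=.
  have [/andP[/eqP-> /eqP->]|nz] := ifP.
    rewrite p40 !xpair_eqE !eqxx /= !andbT -mulnA big_distrl /=; apply: eq_bigr => c _.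
    congr (_ * _)%N; rewrite -{1}cardF -mulnA -sum_nat_const; apply: eq_bigr => y _.
    rewrite -cardF -sum_nat_const; apply: eq_bigr => z _.
    by rewrite !mul0r !add0r !subr0.
  rewrite big_distrl /=; apply: eq_bigr => c _; congr (_ * _)%N.
  rewrite -[RHS](@sum_lin_eq p3 p2 p1); last by rewrite -negb_and andbC nz.
  apply: eq_bigr => y _; apply: eq_bigr => z _; congr nat_of_bool.
  by rewrite p40 !mul0r !add0r -addrA -opprD subr_eq0 eq_sym addrC.
pose c0 := - quad (p1, p2, (p3, p4)) / p4 ^+ 2.
transitivity (\sum_c C c * (r + n * (c == c0)))%N.
  apply: eq_bigr => c _; congr (_ * _)%N.
  pose d := p2 * p3 - p1 * p4 - p4 ^+ 2 * c.
  have -> : (c == c0) = (d == 0).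
    rewrite -[LHS]subr_eq0 (_ : d = - p4 ^+ 2 * (c - c0)); last first.
      by rewrite /d /c0 /quad /=; field.
    by rewrite mulf_eq0 oppr_eq0 expf_eq0 (negPf p40).
  rewrite -sum_mul_eq [RHS](reindex_inj (addIr (- p2))) [RHS](reindex_inj (mulfI p40)).
  apply: eq_bigr => y _; rewrite [RHS](reindex_inj (addIr (- p3))) [RHS](reindex_inj (mulfI p40)).
  apply: eq_bigr => z _; congr nat_of_bool.
  rewrite -[RHS]subr_eq0 -[LHS](inj_eq (mulfI p40)) mulr0; congr (_ == _).
  by rewrite /d; ring.
under eq_bigr do rewrite mulnDr; rewrite big_split -big_distrl /=; congr (_ + _)%N.
rewrite (bigD1 c0) //= eqxx muln1 mulnC big1 ?addn0 // => c cc0.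
by rewrite (negPf cc0) !muln0.
Qed.

(** * Values of [quad] on a plane *)

Lemma sum_nz2_const k : (\sum_(t : T2 | t != 0%R) k = r * n.+1 * k)%N.
Proof.
rewrite sum_pair_nz /= sum_nz_const.
under eq_bigr do rewrite sum_nat_const cardF.
by rewrite sum_nz_const; lia.
Qed.

Lemma sum_lin_fun (f : F -> nat) a b : (a != 0) || (b != 0) ->
  (\sum_x \sum_y f (a * x + b * y)%R = n * \sum_c f c)%N.
Proof.
move=> ab.
transitivity (\sum_x \sum_y \sum_c f c * (a * x + b * y == c)%R)%N.
  apply: eq_bigr => x _; apply: eq_bigr => y _.
  rewrite (bigD1 (a * x + b * y)) //= eqxx muln1 big1 ?addn0 // => c.
  by rewrite eq_sym => /negPf->; rewrite muln0.
under eq_bigr do rewrite exchange_big /=.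
rewrite exchange_big big_distrr /=; apply: eq_bigr => c _.
under eq_bigr do rewrite -big_distrr /=.
by rewrite -big_distrr /= sum_lin_eq // mulnC.
Qed.

Lemma sum_ev_fun (f : F -> nat) t X : ~~ lnul t X ->
  (\sum_s f (ev s t X) = n * \sum_c f c)%N.
Proof.
rewrite negb_and => nz; rewrite -(sum_lin_fun f nz) pair_bigA; apply: eq_bigr => s _.
by congr f; rewrite /ev; ring.
Qed.

Lemma lnul_quad t X : t != 0 -> quad X != 0 -> ~~ lnul t X.
Proof.
move=> t0; apply: contra => /andP[/eqP e1 /eqP e2]; move: t0; rewrite nz2 => /orP[t1|t2].
  apply/eqP/(mulfI t1); rewrite mulr0.
  transitivity (X.1.1 * (t.1 * X.2.2 - t.2 * X.2.1) + X.2.1 * (t.2 * X.1.1 - t.1 * X.1.2)).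
    by rewrite /quad; ring.
  by rewrite e1 e2; ring.
apply/eqP/(mulfI t2); rewrite mulr0.
transitivity (X.1.2 * (t.1 * X.2.2 - t.2 * X.2.1) + X.2.2 * (t.2 * X.1.1 - t.1 * X.1.2)).
  by rewrite /quad; ring.
by rewrite e1 e2; ring.
Qed.

Lemma lnul_basis P : P != 0 -> exists2 t : T2, t != 0 & ~~ lnul t P.
Proof.
move=> P0; have e1 : (1, 0) != 0 :> T2 by rewrite nz2 oner_eq0.
have e2 : (0, 1) != 0 :> T2 by rewrite nz2 oner_eq0 orbT.
have [l1|] := boolP (lnul (1, 0) P); last by exists (1, 0).
exists (0, 1) => //; apply: contra P0 => l2; move: l1 l2.
rewrite /lnul /= !(mul0r, mul1r, subr0, sub0r, oppr_eq0) => /andP[/eqP a /eqP b] /andP[/eqP c /eqP d].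
by case: P a b c d => [[p1 p2] [p3 p4]] /= -> -> -> ->.
Qed.

(** Averaging over s with t fixed: an X with [quad X] nonzero is not annihilated by t, so
    [ev s t X = 1] for exactly n vectors s, and n times the count is a sum of the affine counts
    above. *)
Lemma sum_quad_plane (C : pred F) P : ~~ C 0 ->
  (\sum_X ((polar P X == 0) && C (quad X))%R
   = if P == 0%R then #[c | C c] * (r * n.+1 * n)
     else #[c | C c] * (r * n) + n * \sum_(y : F | y != 0%R) C (- quad P / y ^+ 2)%R)%N.
Proof.
move=> C0; have n0 : (0 < n)%N by rewrite expn_gt0.
have main t : t != 0 ->
    (n * \sum_X ((polar P X == 0) && C (quad X))%R
     = \sum_(s : T2 | s != 0%R) \sum_X ((polar P X == 0) && ((ev s t X == 1) && C (quad X)))%R)%N.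
  move=> t0; rewrite big_distrr exchange_big /=; apply: eq_bigr => X _.
  have [PX|] := eqVneq (polar P X) 0; last by rewrite muln0 big1.
  have [CX|] := boolP (C (quad X)); last by rewrite muln0 big1 // => s _; rewrite andbF.
  have lX : ~~ lnul t X by apply: lnul_quad t0 _; apply: contraNneq C0 => <-.
  rewrite [RHS]big_mkcond /=.
  transitivity (n * \sum_(c : F) (c == 1)%R)%N.
    by rewrite [in RHS](bigD1 1) //= eqxx big1 // => c /negPf->.
  rewrite -(sum_ev_fun (fun c => (c == 1%R) : nat) lX); apply: eq_bigr => s _.
  rewrite andbT; have [->|//] := eqVneq s 0.
  by rewrite /ev !mul0r !addr0 !subr0 eq_sym oner_eq0.
have [P0|P0] := eqVneq P 0.
  have e1 : (1, 0) != 0 :> T2 by rewrite nz2 oner_eq0.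
  apply/eqP; rewrite -(eqn_pmul2l n0) (main _ e1); apply/eqP.
  transitivity (\sum_(s : T2 | s != 0%R) #[c | C c] * (n * n))%N; last first.
    by rewrite sum_nz2_const; lia.
  apply: eq_bigr => s s0; rewrite sum_affine_quadric // P0 /ev /lnul /rnul /=.
  by rewrite !(mulr0, addr0, subr0) !eqxx muln1.
have [t t0 lt] := lnul_basis P0.
apply/eqP; rewrite -(eqn_pmul2l n0) (main _ t0); apply/eqP.
(* Since t does not annihilate P, the doubly degenerate case never occurs and the affine count is a
   function of [ev s t P] alone. The extra [f 0] below is the term s = 0 missing from the sum. *)
pose f y := (if (y != 0)%R then #[c | C c] * r + n * C (- quad P / y ^+ 2)%R else #[c | C c] * n)%N.
have E : (\sum_(s : T2 | s != 0%R) f (ev s t P) + f 0%R = n * \sum_y f y)%N.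
  rewrite -(sum_ev_fun f lt) [RHS](bigD1 (0 : T2)) //= addnC; congr (_ + _)%N.
  by congr f; rewrite /ev /= !(mul0r, addr0, subr0).
transitivity (\sum_(s : T2 | s != 0%R) f (ev s t P))%N.
  by apply: eq_bigr => s s0; rewrite sum_affine_quadric // (negPf lt).
move: E; rewrite [X in (_ = _ * X)%N](bigD1 0) //=.
rewrite (eq_bigr (fun y => #[c | C c] * r + n * C (- quad P / y ^+ 2)%R))%N; last first.
  by move=> y y0; rewrite /f y0.
have f0 : f 0 = (#[c | C c] * n)%N by rewrite /f eqxx.
rewrite big_split /= sum_nz_const -big_distrr /= f0.
move: (\sum_(s | _) _)%N (\sum_(y | _) _)%N #[c | C c] => u v c.
rewrite (_ : n = r.+1); last by lia.
by move: r => k; lia.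
Qed.

Lemma polar_scale P a X : polar P (scale4 a X) = a * polar P X.
Proof. by rewrite /polar /=; ring. Qed.

Lemma ev_scale s t a X : ev s t (scale4 a X) = a * ev s t X.
Proof. by rewrite /ev /=; ring. Qed.

Lemma quad_scale a X : quad (scale4 a X) = a ^+ 2 * quad X.
Proof. by rewrite /quad /=; ring. Qed.

Lemma scale4_inj a : a != 0 -> injective (@scale4 F a).
Proof.
move=> a0 [[? ?] [? ?]] [[? ?] [? ?]] [].
by move=> /(mulfI a0)-> /(mulfI a0)-> /(mulfI a0)-> /(mulfI a0)->.
Qed.

(** Scaling X by y carries the slice [ev s t X = 1] onto the slice with value y and leaves the
    quotient tested by C unchanged. *)
Lemma sum_scale (C : pred F) s t P :
  (\sum_X ((polar P X == 0) && ((ev s t X != 0) && C (quad X / ev s t X ^+ 2)))%R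
   = r * \sum_X ((polar P X == 0) && ((ev s t X == 1) && C (quad X)))%R)%N.
Proof.
rewrite -sum_nz_const.
transitivity (\sum_X \sum_(y : F | y != 0%R)
    ((polar P X == 0) && ((ev s t X == y) && C (quad X / y ^+ 2)))%R)%N.
  apply: eq_bigr => X _; have [e0|e0] := eqVneq (ev s t X) 0.
    by rewrite andbF e0 big1 // => y; rewrite eq_sym => /negPf->; rewrite andbF.
  rewrite [RHS](bigD1 (ev s t X)) //= eqxx big1 ?addn0 // => y /andP[_].
  by rewrite eq_sym => /negPf->; rewrite andbF.
rewrite exchange_big; apply: eq_bigr => y y0.
rewrite (reindex_inj (scale4_inj y0)); apply: eq_bigr => X _.
rewrite polar_scale ev_scale quad_scale mulf_eq0 (negPf y0) /=.
rewrite -[X in y * _ == X]mulr1 (inj_eq (mulfI y0)) [y ^+ 2 * _]mulrC mulfK //.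
by rewrite expf_neq0.
Qed.

(** * Rank-one matrices and the correction term for O *)

Definition nul s t P := lnul t P && rnul (frob2 q s) P.

Lemma lnulP t P : t != 0 -> reflect (exists ab : T2,
  P = ((ab.2 * t.1, ab.2 * t.2), (ab.1 * t.1, ab.1 * t.2))) (lnul t P).
Proof.
move=> t0; apply: (iffP andP) => [[/eqP e1 /eqP e2]|[[a b] ->]]; last first.
  by split; apply/eqP => /=; ring.
have [|a Ea] := @det2_eq0 (P.2.1, P.2.2) t t0; first by rewrite /det2.
have [|b Eb] := @det2_eq0 (P.1.1, P.1.2) t t0.
  by rewrite /det2 /= -[RHS]oppr0 -e2; ring.
by exists (a, b); case: P Ea Eb {e1 e2} => [[? ?] [? ?]] /= [-> ->] [-> ->].
Qed.

Lemma rnul_lnul s t a b : t != 0 ->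
  rnul s ((b * t.1, b * t.2), (a * t.1, a * t.2)) = (s.1 * a - s.2 * b == 0).
Proof.
move=> t0; rewrite /rnul /=.
rewrite (_ : _ - _ = (s.1 * a - s.2 * b) * t.2); last by ring.
rewrite (_ : s.2 * _ - _ = - (s.1 * a - s.2 * b) * t.1); last by ring.
rewrite !mulf_eq0 oppr_eq0; case: (s.1 * a - s.2 * b == 0) => //=.
by apply: negbTE; rewrite negb_and orbC -nz2.
Qed.

(** If P has rows b t and a t, then [herm q P] is minus the norm of [bar t.1 * a - bar t.2 * b]. *)
Lemma rnul_herm t P : t != 0 -> lnul t P -> rnul (frob2 q t) P = (herm q P == 0).
Proof.
move=> t0 /(lnulP _ t0)[[a b] ->] /=; rewrite rnul_lnul //= -[LHS]norm_eq0 -[LHS]oppr_eq0.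
by congr (_ == 0); rewrite /herm /= barD barN !barM !barK; ring.
Qed.

(** A nonzero singular P is annihilated by a single line of vectors t, and [rnul_herm] reduces the
    other half of [nul] to [herm q P = 0]: the sum is r times the indicator of O. *)
Lemma sum_nul_diag P : P != 0 ->
  (\sum_(t : T2 | t != 0%R) nul t t P = r * ((quad P == 0) && (herm q P == 0))%R)%N.
Proof.
move=> P0.
transitivity (\sum_(t : T2 | t != 0%R) (lnul t P * (herm q P == 0)%R))%N.
  apply: eq_bigr => t t0; rewrite /nul mulnb.
  by have [lt|//] := boolP (lnul t P); rewrite rnul_herm.
rewrite -big_distrl -mulnb mulnA /=; congr (_ * _)%N.
have [Q0|Q0] := eqVneq (quad P) 0; last first.
  by rewrite muln0 big1 // => t t0; rewrite (negPf (lnul_quad t0 Q0)).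
rewrite muln1 -[RHS](@sum_ker2 P.2.2 (- P.2.1) (- P.1.2) P.1.1).
- apply: eq_bigr => t _; rewrite /lnul; congr nat_of_bool; congr andb; congr (_ == 0); ring.
- by move: P0; case: (P) => [[? ?] [? ?]]; rewrite !xpair_eqE !oppr_eq0 !negb_and /= -!orbA; do 4!case: eqP.
- by apply/eqP; rewrite -subr_eq0 -Q0 /quad; apply/eqP; ring.
Qed.

Lemma sum_bar_affine a b : a != 0 -> #[x | b + bar x * a == 0] = 1%N.
Proof.
move=> a0; rewrite -(sum_affine_eq b a0) [RHS](reindex_inj (can_inj barK)) /=.
by apply: eq_bigr => x _; rewrite addrC mulrC.
Qed.

Lemma frob2_eq0 t : (frob2 q t == 0) = (t == 0).
Proof. by rewrite !xpair_eqE /= !bar_eq0. Qed.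

Lemma lnul_evh t P : t != 0 -> lnul t P = (h t t P == 0) && (h (base2 t) t P == 0).
Proof.
move=> t0; have := bar_det2_base t0; set b := base2 t => bt.
pose x := t.1 * P.2.2 - t.2 * P.2.1; pose y := t.2 * P.1.1 - t.1 * P.1.2.
have ex s' : h s' t P = bar s'.1 * x + bar s'.2 * y by rewrite /ev /x /y /=; ring.
rewrite !ex /lnul -/x -/y; apply/andP/andP => -[/eqP e1 /eqP e2].
  by rewrite e1 e2 !mulr0 addr0.
split; apply/eqP; rewrite -[LHS]mul1r -bt.
  transitivity ((bar b.1 * x + bar b.2 * y) * bar t.2 - (bar t.1 * x + bar t.2 * y) * bar b.2).
    by ring.
  by rewrite e1 e2; ring.
transitivity ((bar t.1 * x + bar t.2 * y) * bar b.1 - (bar b.1 * x + bar b.2 * y) * bar t.1).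
  by ring.
by rewrite e1 e2; ring.
Qed.

(** If [h t t P] is nonzero, [h s t P] vanishes once on the affine line of s; otherwise it is
    constant there. If that constant is 0, P is a multiple of s^q t^T for the s of one line through
    the origin, which either is spanned by t or meets the affine line exactly once. *)
Lemma sum_nul_line t P : P != 0 -> t != 0 ->
  (\sum_(s | (det2 s t == 1)%R) (h s t P == 0)%R + (h t t P == 0)%R
   = 1 + n * \sum_(s | (det2 s t == 1)%R) nul s t P + n * nul t t P)%N.
Proof.
move=> P0 t0; rewrite !sum_det1 //; have bt := bar_det2_base t0.
set b := base2 t in bt *.
under eq_bigr do rewrite evh_lin2.
rewrite /nul lnul_evh // -/b; have [h0|h0] := eqVneq (h t t P) 0; last first.
  by rewrite sum_bar_affine //= sum_nat_const !muln0.
under eq_bigr do rewrite h0 mulr0 addr0.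
rewrite sum_nat_const cardF addnC -addnA -mulnDr /=; congr (_ + _ * _)%N.
have [hb|hb] := eqVneq (h b t P) 0; last by rewrite sum_nat_const muln0.
have lt : lnul t P by rewrite lnul_evh // h0 hb eqxx.
have [[a c] /= PE] := lnulP _ t0 lt.
have ac : (a != 0) || (c != 0).
  by apply: contraR P0; rewrite negb_or !negbK PE => /andP[/eqP-> /eqP->]; rewrite !mul0r.
pose phi s := bar s.1 * a - bar s.2 * c.
have rn s : rnul (frob2 q s) P = (phi s == 0) by rewrite PE rnul_lnul.
rewrite rn /=; under eq_bigr do rewrite rn.
have phi_lin x : phi (lin2 b x t) = phi b + bar x * phi t.
  by rewrite /phi /lin2 /= !barD !barM; ring.
under eq_bigr do rewrite phi_lin.
have [p0|p0] := eqVneq (phi t) 0; last by rewrite sum_bar_affine.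
under eq_bigr do rewrite p0 mulr0 addr0.
(* A common zero of phi at the basis b, t would give a = c = 0 and hence P = 0. *)
suff /negPf-> : phi b != 0 by rewrite sum_nat_const muln0.
apply/eqP => pb; move: ac; rewrite -[a]mul1r -[c]mul1r -bt.
have -> : (bar b.1 * bar t.2 - bar b.2 * bar t.1) * a = phi b * bar t.2 - phi t * bar b.2.
  by rewrite /phi; ring.
have -> : (bar b.1 * bar t.2 - bar b.2 * bar t.1) * c = phi b * bar t.1 - phi t * bar b.1.
  by rewrite /phi; ring.
by rewrite p0 pb !mul0r subrr eqxx.
Qed.

Lemma sum_nul_SL2 P : P != 0 ->
  (\sum_(t : T2 | t != 0%R) \sum_(s | (det2 s t == 1)%R) (h s t P == 0)%R
   + \sum_(t : T2 | t != 0%R) (h t t P == 0)%R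
   = r * n.+1 + n * \sum_(t : T2 | t != 0%R) \sum_(s | (det2 s t == 1)%R) nul s t P
     + n * \sum_(t : T2 | t != 0%R) nul t t P)%N.
Proof.
move=> P0; rewrite -[(r * n.+1)%N]muln1 -sum_nz2_const !big_distrr -!big_split /=.
by apply: eq_bigr => t t0; rewrite sum_nul_line.
Qed.

(** * Intersections with planes *)

(* The points of F_gamma = 0 off O, gamma = w + 1/w, whose join with their conjugate
   is a secant (inSec), resp. external (inExt), line of the elliptic quadric O. For
   gamma <> 0 the condition on [quad X ^+ halfexp] follows from the other one
   (form_locus); for gamma = 0 it separates H_1 from H_2. *)
Definition inSec w X :=
  (quad X ^+ halfexp == w ^+ q.+1) && (herm q X == (w + w^-1) * quad X ^+ m.+1).

Definition inExt w X :=
  (quad X ^+ halfexp == w ^+ m.*2) && (herm q X == (w + w^-1) * quad X ^+ m.+1).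

Definition affine_count (C : pred F) P s t :=
  (\sum_X ((polar P X == 0) && ((ev s t X == 1) && C (quad X)))%R)%N.

Lemma affine_countE (C : pred F) P s t :
  (r * affine_count C P s t
   = \sum_X ((polar P X == 0) && ((ev s t X != 0) && C (quad X / ev s t X ^+ 2)))%R)%N.
Proof. by rewrite sum_scale. Qed.

Lemma class_scale c y e : y != 0 ->
  ((c / y ^+ 2) ^+ halfexp == e) = (c ^+ halfexp == e).
Proof.
move=> y0; rewrite expr_div_n -exprM halfexp_mul -[y ^+ _]mul1r.
suff -> : y ^+ #|F|.-1 = 1 by rewrite mul1r divr1.
by apply: (mulfI y0); rewrite -exprS prednK ?expf_card ?mulr1 // ltnW // finNzRing_gt1.
Qed.

Lemma coset_class c w : c ^+ m == w -> c ^+ halfexp == w ^+ q.+1.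
Proof.
move/eqP => <-; rewrite -exprM; apply/eqP; congr (_ ^+ _).
by rewrite /halfexp; clear; lia.
Qed.

Lemma coset_classE c w : w ^+ (2 * m.*2) = 1 -> c ^+ m.+1 == - w^-1 -> c ^+ halfexp == w ^+ m.*2.
Proof.
move=> w1 /eqP cw.
have w0 : w != 0 by apply: expf1_neq0 w1; rewrite muln_gt0 double_gt0 m_gt0.
rewrite (_ : halfexp = m.+1 * m.*2)%N; last by rewrite /halfexp; lia.
rewrite exprM cw exprNn -signr_odd odd_double mul1r exprVn.
rewrite -(inj_eq (mulfI (expf_neq0 m.*2 w0))) divff ?expf_neq0 //.
by rewrite -expr2 -exprM mulnC w1.
Qed.

(** Summing the pointwise identity over the plane leaves the number Z of pairs (t, X) with
    [h t t X = 0]. The trivial count over the whole quadratic class contains the same Z, and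
    comparing the two eliminates it. *)
Lemma sum_S_planes w P : w ^+ (2 * q.+1) = 1 -> w ^+ 2 != 1 ->
  (q * #[X | (polar P X == 0) && inSec w X]
   + \sum_(t : T2 | t != 0%R) affine_count (fun c => c ^+ m == w)%R P (frob2 q t) t
   + 2 * m * q * #[X | (polar P X == 0) && (quad X ^+ halfexp == w ^+ q.+1)]
   = \sum_(t : T2 | t != 0%R) affine_count (fun c => c ^+ halfexp == w ^+ q.+1)%R P (frob2 q t) t)%N.
Proof.
move=> w1 w2.
pose U X := (polar P X == 0) && (quad X ^+ halfexp == w ^+ q.+1).
pose Z := (\sum_(t : T2 | t != 0%R) \sum_X (U X && (h t t X == 0)%R))%N.
have E1 : (r * \sum_(t : T2 | t != 0%R) affine_count (fun c => c ^+ m == w)%R P (frob2 q t) t + Z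
           + q * r * #[X | (polar P X == 0) && inSec w X] = r * q.+1 * \sum_X U X)%N.
  rewrite /Z !big_distrr /=.
  under eq_bigr do rewrite affine_countE.
  rewrite exchange_big /= [X in (_ + X + _)%N]exchange_big /= -!big_split /=.
  apply: eq_bigr => X _; rewrite /inSec /U.
  have [PX|_] := eqVneq (polar P X) 0; last by rewrite !big1 // !muln0.
  have [sg|sg] := eqVneq (quad X ^+ halfexp) (w ^+ q.+1).
    by rewrite muln1 -(sum_S_pointwise w1 w2 sg) .
  rewrite !muln0 addn0 !big1 // => t t0; apply/eqP; rewrite eqb0 /=; apply/negP => /andP[y0].
  by move/coset_class; rewrite class_scale // (negPf sg).
have E2 : (Z + r * \sum_(t : T2 | t != 0%R) affine_count (fun c => c ^+ halfexp == w ^+ q.+1)%R P (frob2 q t) t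
           = r * n.+1 * \sum_X U X)%N.
  rewrite /Z !big_distrr /=.
  under [X in (_ + X)%N]eq_bigr do rewrite affine_countE.
  rewrite -big_split /=.
  rewrite [RHS](eq_bigr (fun X => \sum_(t : T2 | t != 0%R) U X)%N); last by move=> X _; rewrite sum_nz2_const.
  rewrite exchange_big /=; apply: eq_bigr => t _; rewrite -big_split /=; apply: eq_bigr => X _.
  rewrite /U; have [//|h0] := eqVneq (h t t X) 0; first by rewrite andbT andbF addn0.
  by rewrite andbF class_scale.
have r0 : (0 < r)%N by rewrite !muln_gt0 m_gt0.
(* The coefficient [2 * m * q] is (n+1) - (q+1). *)
have cancel (A B y a v : nat) : (r * A + y + q * r * a = r * q.+1 * v ->
    y + r * B = r * n.+1 * v -> q * a + A + 2 * m * q * v = B)%N.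
  move=> e1 e2; apply/eqP; rewrite -(eqn_pmul2l r0); apply/eqP.
  apply: (@addnI y); rewrite e2.
  transitivity ((r * A + y + q * r * a) + r * (2 * m * q * v))%N; first by lia.
  by rewrite e1; lia.
exact: cancel E1 E2.
Qed.

(** As h^(2(m+1)) is the norm of h, the condition N h = - w Q^(m+1) is the condition (Q/h^2)^(m+1) =
    - 1/w on the quotient, so it can be summed through affine counts. *)
Lemma sum_E_planes w P : w ^+ (2 * m.*2) = 1 -> w ^+ 2 != 1 ->
  (\sum_(t : T2 | t != 0%R) \sum_(s | (det2 s t == 1)%R)
      affine_count (fun c => c ^+ m.+1 == - w^-1)%R P (frob2 q s) t
   = q.+1 * \sum_(t : T2 | t != 0%R) affine_count (fun c => c ^+ halfexp == w ^+ m.*2)%R P (frob2 q t) t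
   + n * #[X | (polar P X == 0) && inExt w X])%N.
Proof.
move=> w1 w2.
have w0 : w != 0 by apply: expf1_neq0 w1; rewrite muln_gt0 double_gt0 m_gt0.
have r0 : (0 < r)%N by rewrite !muln_gt0 m_gt0.
apply/eqP; rewrite -(eqn_pmul2l r0); apply/eqP.
rewrite mulnDr [X in (_ = X + _)%N]mulnCA [X in (_ = _ + X)%N]mulnA.
rewrite [X in (_ = _ + X * _)%N]mulnC !big_distrr /=.
under eq_bigr do (rewrite big_distrr /=; under eq_bigr do rewrite affine_countE; rewrite exchange_big /=).
rewrite exchange_big /=.
under [X in (_ = X + _)%N]eq_bigr do rewrite affine_countE big_distrr /=.
rewrite [X in (_ = X + _)%N]exchange_big /= -big_split /=; apply: eq_bigr => X _.
rewrite -big_distrr /= /inExt.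
have [PX|_] := eqVneq (polar P X) 0; last by rewrite !big1 ?muln0 // => t _; rewrite big1.
have [sg|sg] := eqVneq (quad X ^+ halfexp) (w ^+ m.*2); last first.
  rewrite !muln0 addn0 !big1 ?muln0 // => t t0.
    by apply/eqP; rewrite eqb0 /=; apply/negP => /andP[y0]; rewrite class_scale // (negPf sg).
  rewrite big1 // => s _; apply/eqP; rewrite eqb0 /=; apply/negP => /andP[y0].
  by move/(coset_classE w1); rewrite class_scale // (negPf sg).
have Q0 : quad X != 0.
  apply: contra_eq_neq sg => ->; rewrite expr0n gtn_eqF ?muln_gt0 ?m_gt0 // eq_sym.
  by rewrite expf_neq0.
transitivity (\sum_(t : T2 | t != 0%R) \sum_(s | (det2 s t == 1)%R)
    (N (h s t X) == - (w * quad X ^+ m.+1))%R)%N.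
  apply: eq_bigr => t _; apply: eq_bigr => s _; congr nat_of_bool; rewrite /=.
  have [->|y0] := eqVneq (h s t X) 0.
    by rewrite mul0r [RHS]eq_sym oppr_eq0 mulf_eq0 (negPf w0) expf_eq0 (negPf Q0) ?andbF.
  rewrite /= expr_div_n -exprM mulnC exprM half_norm //.
  have N0 : N (h s t X) != 0 by rewrite norm_eq0.
  rewrite -[LHS](inj_eq (mulIf N0)) divfK // -[LHS](inj_eq (mulfI w0)) eq_sym.
  by rewrite mulrA mulrN divff // mulN1r eqr_oppLR.
rewrite (sum_E_pointwise w1 w2 sg) /= -mulnA; congr (_ * _ + _)%N.
by apply: eq_bigr => t _; have [//|y0] := eqVneq (h t t X) 0; rewrite /= class_scale // sg eqxx.
Qed.

Lemma halfexp_even : ~~ odd halfexp.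
Proof. by rewrite /halfexp oddM. Qed.

Lemma expN_half a : (- a) ^+ halfexp = a ^+ halfexp.
Proof. by rewrite exprNn -signr_odd (negPf halfexp_even) mul1r. Qed.

(** The [nul] term on the left compensates for the empty slice when P is a multiple of s^q t^T, so
    that one formula covers every P with [h s t P = 0]. *)
Lemma affine_count_nul (C : pred F) P s t : P != 0 -> s != 0 -> t != 0 ->
  (affine_count C P (frob2 q s) t + #[c | C c] * n * nul s t P
   = #[c | C c] * r * (h s t P != 0)%R
     + n * ((h s t P != 0) && C (- quad P / h s t P ^+ 2))%R + #[c | C c] * n * (h s t P == 0)%R)%N.
Proof.
move=> P0 s0 t0; rewrite /affine_count sum_affine_quadric ?frob2_eq0 // /nul (negPf P0) muln0.
have fs0 : frob2 q s != 0 by rewrite frob2_eq0.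
have [e0|e0] := eqVneq (h s t P) 0; rewrite !muln0 ?muln1 ?add0n /=.
  by case: ifP => _; rewrite ?muln1 ?muln0 ?addn0.
by rewrite !addn0 (lnulE _ _ fs0) (negPf e0) muln0 addn0.
Qed.

Lemma affine_count0 (C : pred F) s t : s != 0 -> t != 0 ->
  affine_count C 0 (frob2 q s) t = (#[c | C c] * (n * n))%N.
Proof.
move=> s0 t0; rewrite /affine_count sum_affine_quadric ?frob2_eq0 //.
by rewrite /ev /lnul /rnul /= !(mulr0, addr0, subr0) !eqxx muln1.
Qed.

Lemma card_class a : a ^+ 2 = 1 -> #[c | c ^+ halfexp == a] = halfexp.
Proof. by apply: sum_expf_eq; rewrite mulnC halfexp_mul. Qed.

Lemma card_coset w : w ^+ (2 * q.+1) = 1 -> #[c | c ^+ m == w] = m.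
Proof. exact: sum_expf_eq m_mul. Qed.

Lemma card_cosetE w : w ^+ (2 * m.*2) = 1 -> #[c | c ^+ m.+1 == - w^-1] = m.+1.
Proof.
move=> w1; apply: sum_expf_eq mS_mul _.
by rewrite exprNn exprVn w1 invr1 -signr_odd mul2n odd_double mulr1.
Qed.

Lemma sum_diag_total P :
  (\sum_(t : T2 | t != 0%R) (h t t P != 0)%R + \sum_(t : T2 | t != 0%R) (h t t P == 0)%R
   = r * n.+1)%N.
Proof.
rewrite -big_split /= -[RHS]muln1 -sum_nz2_const; apply: eq_bigr => t _.
by case: eqP.
Qed.

Lemma sum_affine_diag (C : pred F) P : P != 0 ->
  (\sum_(t : T2 | t != 0%R) affine_count C P (frob2 q t) t
     + #[c | C c] * n * \sum_(t : T2 | t != 0%R) nul t t P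
   = #[c | C c] * r * \sum_(t : T2 | t != 0%R) (h t t P != 0)%R
     + n * \sum_(t : T2 | t != 0%R) ((h t t P != 0) && C (- quad P / h t t P ^+ 2))%R
     + #[c | C c] * n * \sum_(t : T2 | t != 0%R) (h t t P == 0)%R)%N.
Proof.
move=> P0; rewrite !big_distrr -!big_split /=; apply: eq_bigr => t t0.
exact: affine_count_nul.
Qed.

Lemma sum_class_diag a P :
  (\sum_(t : T2 | t != 0%R) ((h t t P != 0) && ((- quad P / h t t P ^+ 2) ^+ halfexp == a))%R
   = (quad P ^+ halfexp == a)%R * \sum_(t : T2 | t != 0%R) (h t t P != 0)%R)%N.
Proof.
rewrite big_distrr; apply: eq_bigr => t _ /=; have [//|h0] := eqVneq (h t t P) 0; first by rewrite muln0.
by rewrite class_scale // expN_half muln1.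
Qed.

Lemma sum_quad_class a P : P != 0 -> a ^+ 2 = 1 ->
  #[X | (polar P X == 0) && (quad X ^+ halfexp == a)]
  = (halfexp * (r * n) + n * (r * (quad P ^+ halfexp == a)%R))%N.
Proof.
move=> P0 a2; have a0 : a != 0 by apply: expf1_neq0 a2.
rewrite (sum_quad_plane (C := fun c => c ^+ halfexp == a)); last first.
  by rewrite expr0n gtn_eqF ?muln_gt0 ?m_gt0 // eq_sym.
rewrite (negPf P0) card_class //; congr (_ + n * _)%N; rewrite -sum_nz_const.
by apply: eq_bigr => y y0; rewrite class_scale // expN_half.
Qed.

Lemma eq_signM k a b : ((-1) ^+ k * a == b) = (a == (-1) ^+ k * b).
Proof.
have s0 : (-1) ^+ k != 0 :> F by rewrite signr_eq0.
by rewrite -[LHS](inj_eq (mulfI s0)) mulrA -expr2 sqrr_sign mul1r.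
Qed.

Lemma expr_signM k w : ((-1) ^+ k * w) ^+ 2 = w ^+ 2.
Proof. by rewrite exprMn sqrr_sign mul1r. Qed.

Lemma expr_signM_even k w j : ~~ odd j -> ((-1) ^+ k * w) ^+ j = w ^+ j.
Proof. by move=> oj; rewrite -(odd_double_half j) (negPf oj) add0n -mul2n !exprM expr_signM. Qed.

(* Up to a factor q, the conclusion is the combination of the hypotheses with
   coefficients 1, -1, 1, c - d, -n (c and d as in the proof). *)
Lemma arith_S (aS A B z zc k0 bA cS : nat) (e : bool) :
  (q * aS + A + 2 * m * q * (halfexp * (r * n) + n * (r * e)) = B ->
   A + m * n * k0 = m * r * zc + n * bA + m * n * z ->
   B + halfexp * n * k0 = halfexp * r * zc + n * (e * zc) + halfexp * n * z ->
   zc + z = r * n.+1 ->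
   bA + q * r * cS + e * z = e * (r * q.+1) ->
   aS + m * n * k0 = m * (r * r + z) + n * r * cS)%N.
Proof.
move=> H HA HB HT HP; apply/eqP; rewrite -(@eqn_pmul2l q) //; apply/eqP.
pose c := (halfexp * r + n * e)%N; pose d := (m * r)%N.
pose v := (halfexp * (r * n) + n * (r * e))%N.
have E : (q * (aS + m * n * k0) + (B + (A + m * n * k0)
    + (halfexp * r * zc + n * (e * zc) + halfexp * n * z)
    + n * (bA + q * r * cS + e * z) + c * (r * n.+1) + d * (zc + z))
  = q * (m * (r * r + z) + n * r * cS) + ((q * aS + A + 2 * m * q * v)
    + (m * r * zc + n * bA + m * n * z) + (B + halfexp * n * k0)
    + n * (e * (r * q.+1)) + c * (zc + z) + d * (r * n.+1)))%N.
  by rewrite /c /d /v /halfexp -addnn; ring.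
by move: E; rewrite H HA HB HP HT => /addIn.
Qed.

Lemma plane_count_S w P : w ^+ (2 * q.+1) = 1 -> w ^+ 2 != 1 -> P != 0 ->
  (#[X | (polar P X == 0) && inSec w X] + m * n * (r * ((quad P == 0) && (herm q P == 0))%R)
   = m * (r * r + \sum_(t : T2 | t != 0%R) (h t t P == 0)%R)
     + n * r * inSec ((-1) ^+ m * w)%R P)%N.
Proof.
move=> w1 w2 P0; rewrite -(sum_nul_diag P0).
have a2 : (w ^+ q.+1) ^+ 2 = 1 by rewrite -exprM mulnC.
have H := sum_S_planes P w1 w2.
have HA := @sum_affine_diag (fun c => c ^+ m == w) P P0.
have HB := @sum_affine_diag (fun c => c ^+ halfexp == w ^+ q.+1) P P0.
have HT := sum_diag_total P.
rewrite /= sum_class_diag (card_class a2) in HB; rewrite /= (card_coset w1) in HA.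
rewrite (sum_quad_class P0 a2) in H.
(* The sign of [- quad P] passes through the m-th power to w. Squares and the power q+1, which is
   even, are unaffected, so w' meets the same conditions as w. *)
set w' := (-1) ^+ m * w.
have w'2 : w' ^+ 2 != 1 by rewrite expr_signM.
have w'1 : w' ^+ (2 * q.+1) = 1 by rewrite expr_signM_even // mul2n odd_double.
have w'q : w' ^+ q.+1 = w ^+ q.+1 by rewrite expr_signM_even //= odd_double.
have coset' y : ((- quad P / y ^+ 2) ^+ m == w) = ((quad P / y ^+ 2) ^+ m == w').
  by rewrite mulNr exprNn eq_signM.
have HP : (\sum_(t : T2 | t != 0%R) ((h t t P != 0) && ((- quad P / h t t P ^+ 2) ^+ m == w))%R
   + q * r * inSec w' P
   + (quad P ^+ halfexp == w ^+ q.+1)%R * \sum_(t : T2 | t != 0%R) (h t t P == 0)%R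
   = (quad P ^+ halfexp == w ^+ q.+1)%R * (r * q.+1))%N.
  under eq_bigr do rewrite coset'.
  rewrite /inSec w'q; have [sg|sg] := eqVneq (quad P ^+ halfexp) (w ^+ q.+1).
    have sg' : quad P ^+ halfexp = w' ^+ q.+1 by rewrite w'q.
    by rewrite !mul1n -(sum_S_pointwise w'1 w'2 sg') addnAC.
  rewrite !mul0n muln0 !addn0 big1 // => t t0; apply/eqP; rewrite eqb0; apply/negP => /andP[y0].
  by move/coset_class; rewrite class_scale // w'q (negPf sg).
exact: arith_S H HA HB HT HP.
Qed.

Lemma sum_affine_SL2 (C : pred F) P : P != 0 ->
  (\sum_(t : T2 | t != 0%R) \sum_(s | (det2 s t == 1)%R) affine_count C P (frob2 q s) t
     + #[c | C c] * n * \sum_(t : T2 | t != 0%R) \sum_(s | (det2 s t == 1)%R) nul s t P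
   = #[c | C c] * r * \sum_(t : T2 | t != 0%R) \sum_(s | (det2 s t == 1)%R) (h s t P != 0)%R
     + n * \sum_(t : T2 | t != 0%R) \sum_(s | (det2 s t == 1)%R)
         ((h s t P != 0) && C (- quad P / h s t P ^+ 2))%R
     + #[c | C c] * n * \sum_(t : T2 | t != 0%R) \sum_(s | (det2 s t == 1)%R) (h s t P == 0)%R)%N.
Proof.
move=> P0; rewrite !big_distrr -!big_split /=; apply: eq_bigr => t t0.
rewrite !big_distrr -!big_split /=; apply: eq_bigr => s st.
apply: affine_count_nul => //; apply: contraTneq st => ->.
by rewrite /det2 !mul0r subrr eq_sym oner_eq0.
Qed.

Lemma sum_SL2_const k :
  (\sum_(t : T2 | t != 0%R) \sum_(s | (det2 s t == 1)%R) k = n * (r * n.+1) * k)%N.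
Proof.
transitivity (\sum_(t : T2 | t != 0%R) n * k)%N; last by rewrite sum_nz2_const; lia.
by apply: eq_bigr => t t0; rewrite sum_det1 // sum_nat_const cardF.
Qed.

Lemma sum_SL2_total P :
  (\sum_(t : T2 | t != 0%R) \sum_(s | (det2 s t == 1)%R) (h s t P != 0)%R
   + \sum_(t : T2 | t != 0%R) \sum_(s | (det2 s t == 1)%R) (h s t P == 0)%R
   = n * (r * n.+1))%N.
Proof.
rewrite -big_split /= -[RHS]muln1 -sum_SL2_const; apply: eq_bigr => t _.
by rewrite -big_split; apply: eq_bigr => s _; case: eqP.
Qed.

(* Here the factor is n and the coefficients are -1, 1, -2(m+1), (m+1)r,
   -(m+1)r^2, n, m+1. *)
Lemma arith_E (aE B D y yc kSL z zc k0 bD cE : nat) (e : bool) :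
  (D = q.+1 * B + n * aE ->
   D + m.+1 * n * kSL = m.+1 * r * yc + n * bD + m.+1 * n * y ->
   B + halfexp * n * k0 = halfexp * r * zc + n * (e * zc) + halfexp * n * z ->
   yc + y = n * (r * n.+1) ->
   zc + z = r * n.+1 ->
   bD = e * (q.+1 * zc) + n * r * cE ->
   y + z = r * n.+1 + n * kSL + n * k0 ->
   aE + m.+1 * z = m.+1 * (r * n.+1 + n * k0) + n * r * cE)%N.
Proof.
move=> HE HD HB HY HT HP HN; apply/eqP; rewrite -(@eqn_pmul2l n) ?expn_gt0 //; apply/eqP.
have E : (n * (aE + m.+1 * z) + (D + (m.+1 * r * yc + n * bD + m.+1 * n * y)
    + m.+1 * r * (n * (r * n.+1)) + n * (e * (q.+1 * zc) + n * r * cE)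
    + q.+1 * (B + halfexp * n * k0) + m.+1 * r * r * (zc + z)
    + m.+1 * (r * n.+1 + n * kSL + n * k0))
  = n * (m.+1 * (r * n.+1 + n * k0) + n * r * cE) + ((q.+1 * B + n * aE)
    + (D + m.+1 * n * kSL) + m.+1 * r * (yc + y) + n * bD
    + q.+1 * (halfexp * r * zc + n * (e * zc) + halfexp * n * z)
    + m.+1 * r * r * (r * n.+1) + m.+1 * (y + z)))%N.
  by rewrite /halfexp -addnn; ring.
by move: E; rewrite -HE HD HB HY HT -HP HN => /addIn.
Qed.

Lemma plane_count_E w P : w ^+ (2 * m.*2) = 1 -> w ^+ 2 != 1 -> P != 0 ->
  (#[X | (polar P X == 0) && inExt w X] + m.+1 * \sum_(t : T2 | t != 0%R) (h t t P == 0)%R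
   = m.+1 * (r * n.+1 + n * (r * ((quad P == 0) && (herm q P == 0))%R))
     + n * r * inExt ((-1) ^+ m.+1 * w)%R P)%N.
Proof.
move=> w1 w2 P0; rewrite -(sum_nul_diag P0).
have w0 : w != 0 by apply: expf1_neq0 w1; rewrite muln_gt0 double_gt0 m_gt0.
have a2 : (w ^+ m.*2) ^+ 2 = 1 by rewrite -exprM mulnC.
have H := sum_E_planes P w1 w2.
have HD := @sum_affine_SL2 (fun c => c ^+ m.+1 == - w^-1) P P0.
have HB := @sum_affine_diag (fun c => c ^+ halfexp == w ^+ m.*2) P P0.
have HT := sum_diag_total P.
have HY := sum_SL2_total P.
have HN := sum_nul_SL2 P0.
rewrite /= sum_class_diag (card_class a2) in HB; rewrite /= (card_cosetE w1) in HD.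
set w' := (-1) ^+ m.+1 * w.
have w'2 : w' ^+ 2 != 1 by rewrite expr_signM.
have w'1 : w' ^+ (2 * m.*2) = 1 by rewrite expr_signM_even // mul2n odd_double.
have w'q : w' ^+ m.*2 = w ^+ m.*2 by rewrite expr_signM_even //= odd_double.
have HP : (\sum_(t : T2 | t != 0%R) \sum_(s | (det2 s t == 1)%R)
     ((h s t P != 0) && ((- quad P / h s t P ^+ 2) ^+ m.+1 == - w^-1))%R
   = (quad P ^+ halfexp == w ^+ m.*2)%R * (q.+1 * \sum_(t : T2 | t != 0%R) (h t t P != 0)%R)
   + n * r * inExt w' P)%N.
  rewrite /inExt w'q; have [sg|sg] := eqVneq (quad P ^+ halfexp) (w ^+ m.*2); last first.
    rewrite mul0n muln0 !big1 // => t t0; rewrite big1 // => s st; apply/eqP.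
    rewrite eqb0; apply/negP => /andP[y0].
    by move/(coset_classE w1); rewrite class_scale // expN_half (negPf sg).
  have Q0 : quad P != 0.
    apply: contra_eq_neq sg => ->; rewrite expr0n gtn_eqF ?muln_gt0 ?m_gt0 // eq_sym.
    by rewrite expf_neq0.
  have sg' : quad P ^+ halfexp = w' ^+ m.*2 by rewrite w'q.
  rewrite mul1n -(sum_E_pointwise w'1 w'2 sg').
  apply: eq_bigr => t _; apply: eq_bigr => s _; congr nat_of_bool; rewrite /=.
  have [->|y0] := eqVneq (h s t P) 0.
    rewrite mul0r [RHS]eq_sym oppr_eq0 -mulrA mulf_eq0 signr_eq0 mulf_eq0 (negPf w0) expf_eq0.
    by rewrite (negPf Q0) ?andbF.
  rewrite /= expr_div_n -exprM mulnC exprM half_norm //.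
  have N0 : N (h s t P) != 0 by rewrite norm_eq0.
  rewrite -[LHS](inj_eq (mulIf N0)) divfK // -[LHS](inj_eq (mulfI w0)) eq_sym.
  by rewrite mulrA mulrN divff // mulN1r eqr_oppLR exprNn /w' mulrCA mulrA.
exact: arith_E H HD HB HY HT HP HN.
Qed.

(** * The elliptic quadric O and the union of the three types *)

Definition isO X := [&& X != 0, quad X == 0 & herm q X == 0].

Lemma polar0 X : polar 0 X = 0.
Proof. by rewrite /polar /= !mul0r addr0 !subr0. Qed.

(** The plane identity at P = 0, where orthogonality is no restriction. It supplies the orbit sizes
    that tell H_1 from H_2. *)
Lemma card_inSec w : w ^+ (2 * q.+1) = 1 -> w ^+ 2 != 1 ->
  #[X | inSec w X] = (m * n * (r * n.+1))%N.
Proof.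
move=> w1 w2; have a2 : (w ^+ q.+1) ^+ 2 = 1 by rewrite -exprM mulnC.
have a0 : w ^+ q.+1 != 0 by apply: expf1_neq0 a2.
have := sum_S_planes 0 w1 w2.
rewrite (sum_quad_plane (C := fun c => c ^+ halfexp == w ^+ q.+1)); last first.
  by rewrite expr0n gtn_eqF ?muln_gt0 ?m_gt0 // eq_sym.
rewrite eqxx (card_class a2).
rewrite [X in (_ = X -> _)%N](eq_bigr (fun=> halfexp * (n * n)))%N; last first.
  by move=> t t0; rewrite affine_count0 // (card_class a2).
rewrite [X in (_ + X + _)%N](eq_bigr (fun=> m * (n * n)))%N; last first.
  by move=> t t0; rewrite affine_count0 // (card_coset w1).
rewrite !sum_nz2_const; under eq_bigr do rewrite polar0 eqxx /=.
move: (\sum_X _)%N => a E; apply/eqP; rewrite -(@eqn_pmul2l q) //; apply/eqP.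
have E' : (q * (m * n * (r * n.+1)) + (r * n.+1 * (m * (n * n)) + 2 * m * q * (halfexp * (r * n.+1 * n)))
  = r * n.+1 * (halfexp * (n * n)))%N by rewrite /halfexp -addnn; ring.
by move: E; rewrite -E' -addnA => /addIn.
Qed.

Lemma card_inExt w : w ^+ (2 * m.*2) = 1 -> w ^+ 2 != 1 ->
  #[X | inExt w X] = (m.+1 * n * (r * n.+1))%N.
Proof.
move=> w1 w2; have a2 : (w ^+ m.*2) ^+ 2 = 1 by rewrite -exprM mulnC.
have := sum_E_planes 0 w1 w2.
rewrite [X in (_ = q.+1 * X + _)%N](eq_bigr (fun=> halfexp * (n * n)))%N; last first.
  by move=> t t0; rewrite affine_count0 // (card_class a2).
rewrite [X in (X = _)%N](eq_bigr (fun t => \sum_(s | (det2 s t == 1)%R) m.+1 * (n * n)))%N; last first.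
  move=> t t0; apply: eq_bigr => s st; rewrite affine_count0 //.
    by rewrite (card_cosetE w1).
  by apply: contraTneq st => ->; rewrite /det2 !mul0r subrr eq_sym oner_eq0.
rewrite sum_nz2_const sum_SL2_const; under eq_bigr do rewrite polar0 eqxx /=.
move: (\sum_X _)%N => a E; apply/eqP; rewrite -(@eqn_pmul2l n) ?expn_gt0 //; apply/eqP.
have E' : (n * (m.+1 * n * (r * n.+1)) + q.+1 * (r * n.+1 * (halfexp * (n * n)))
  = n * (r * n.+1) * (m.+1 * (n * n)))%N by rewrite /halfexp -addnn; ring.
by move: E; rewrite -E' addnC => /addnI.
Qed.

(** For nonzero x1, [quad X = 0] gives X = x1 (1, x, y, x y), and then [herm q X] is minus the norm
    of x1 (y - [bar x]). *)
Lemma quad_herm0 X : quad X = 0 -> herm q X = 0 ->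
  X = if X.1.1 != 0 then ((X.1.1, X.1.2), (X.1.1 * bar (X.1.2 / X.1.1), X.1.1 * N (X.1.2 / X.1.1)))
      else ((0, 0), (0, X.2.2)).
Proof.
case: X => [[x1 x2] [x3 x4]]; rewrite /quad /herm /= => Q H.
have [x10|x10] := eqVneq x1 0 => /=.
  have /eqP : x2 * x3 = 0.
    by transitivity (x1 * x4 - (x1 * x4 - x2 * x3)); [ring | rewrite Q x10 mul0r subrr].
  rewrite mulf_eq0 => /orP[] /eqP z; move: H;
    rewrite x10 z bar0 !(mul0r, mulr0, add0r, sub0r, subr0, addr0, oppr0) => /eqP;
    by rewrite oppr_eq0 norm_eq0 => /eqP->.
pose x := x2 / x1; pose y := x3 / x1.
have e2 : x2 = x1 * x by rewrite /x mulrC divfK.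
have e3 : x3 = x1 * y by rewrite /y mulrC divfK.
have e4 : x4 = x1 * (x * y).
  apply: (mulfI x10); apply/eqP; rewrite -subr_eq0; apply/eqP.
  by transitivity (x1 * x4 - x2 * x3); [rewrite [in RHS]e2 [in RHS]e3; ring | exact: Q].
suff yx : y = bar x by rewrite -/x e3 e4 yx.
apply/eqP; rewrite -subr_eq0 -norm_eq0 barD barN barK.
have : N x1 * ((y - bar x) * (bar y - x)) = 0.
  transitivity (- (bar x1 * x4 + x1 * bar x4 - N x2 - N x3)); last by rewrite H oppr0.
  by rewrite e4 [in RHS]e3 [in RHS]e2 !barM; ring.
by move/eqP; rewrite mulf_eq0 norm_eq0 (negPf x10).
Qed.

Lemma count_O P :
  #[X | (polar P X == 0) && isO X] = (\sum_(t : T2 | t != 0%R) (h t t P == 0)%R)%N.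
Proof.
(* [f t] is t^q t^T divided by the conjugate of the first nonzero coordinate of t. The division
   makes it a bijection onto the nonzero vectors of O, whereas t^q t^T only determines t up to a
   factor of norm 1. *)
pose f t : T4 := if t.1 != 0 then ((t.1, t.2), (t.1 * bar (t.2 / t.1), t.1 * N (t.2 / t.1)))
      else ((0, 0), (0, t.2)).
pose g X : T2 := if X.1.1 != 0 then X.1 else (0, X.2.2).
transitivity (\sum_(X | isO X) (polar P X == 0)%R)%N.
  by rewrite [RHS]big_mkcond; apply: eq_bigr => X _; case: (isO X); rewrite ?andbT ?andbF.
rewrite (reindex_onto f g) /=; last first.
  move=> X /and3P[_ /eqP Q /eqP H]; rewrite [RHS](quad_herm0 Q H) /f /g.
  by have [e|e] := eqVneq X.1.1 0; rewrite /= ?eqxx ?e.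
have gf t : g (f t) = t.
  case: t => t1 t2; rewrite /g /f /=; have [->|t10] := eqVneq t1 0; last by rewrite /= t10.
  by rewrite /= eqxx.
apply: eq_big => t; last move=> _.
  rewrite gf eqxx andbT; apply/and3P/idP => [[nz _ _]|t0].
    apply: contra nz => /eqP->; rewrite /f /= eqxx.
    by rewrite !xpair_eqE eqxx.
  rewrite /f; have [t10|t10] := eqVneq t.1 0 => /=.
    rewrite !xpair_eqE !eqxx /quad /herm /= bar0 !(mul0r, mulr0, subr0, addr0) eqxx; split=> //.
    by move: t0; rewrite nz2 t10 eqxx.
  split; first by rewrite !xpair_eqE (negPf t10).
    by apply/eqP; rewrite /quad /= -[X in _ - X * _](divfK t10); ring.
  by apply/eqP; rewrite /herm /= -[X in _ - X * bar X - _](divfK t10) !barM !barK; ring.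
congr nat_of_bool; rewrite /f; have [t10|t10] := eqVneq t.1 0 => /=.
  rewrite /polar /ev /= t10 bar0 !(mul0r, mulr0, subr0, addr0, add0r) !mulf_eq0 bar_eq0 orbb.
  by rewrite orbC.
pose x := t.2 / t.1; have e2 : t.2 = x * t.1 by rewrite divfK.
have bt : bar t.1 != 0 by rewrite bar_eq0.
rewrite -[LHS](inj_eq (mulfI bt)) mulr0; congr (_ == 0).
by rewrite /polar /ev /= -/x [in LHS]e2 [in RHS]e2 !barM; ring.
Qed.

(** Equal values of w + 1/w leave w' = w or w' = 1/w; with w^(q+1) = w'^(q-1), the common quadratic
    character, either one forces w^2 = 1. *)
Lemma inSec_inExt_disjoint w w' X :
  w ^+ (2 * q.+1) = 1 -> w ^+ 2 != 1 -> w' ^+ (2 * m.*2) = 1 -> w' ^+ 2 != 1 ->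
  inSec w X -> inExt w' X -> False.
Proof.
move=> w1 w2 v1 v2 /andP[/eqP sw /eqP hw] /andP[/eqP sv /eqP hv].
have w0 : w != 0 by apply: expf1_neq0 w1.
have v0 : w' != 0 by apply: expf1_neq0 v1; rewrite muln_gt0 double_gt0 m_gt0.
have Q0 : quad X != 0.
  apply: contra_eq_neq sw => ->; rewrite expr0n gtn_eqF ?muln_gt0 ?m_gt0 // eq_sym.
  by rewrite expf_neq0.
have e : w ^+ q.+1 = w' ^+ m.*2 by rewrite -sw.
have /eqP : (w - w') * (w * w' - 1) = 0.
  have /(mulIf (expf_neq0 m.+1 Q0)) E := etrans (esym hw) hv.
  transitivity (w * w' * ((w + w^-1) - (w' + w'^-1))); first by field; rewrite w0 v0.
  by rewrite E subrr mulr0.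
rewrite mulf_eq0 => /orP[|]; rewrite subr_eq0 => /eqP E.
  move: e; rewrite -E -(addn2 m.*2) exprD -[RHS]mulr1 => /(mulfI (expf_neq0 _ w0)) E2.
  by rewrite E2 eqxx in w2.
have E' : w' = w^-1 by rewrite -[LHS](mulKf w0) E mulr1.
move: v1; rewrite E' exprVn => /(congr1 GRing.inv); rewrite invrK invr1 => w3.
move: e; rewrite E' exprVn => /(congr1 (fun y => y * w ^+ m.*2)).
rewrite mulVf ?expf_neq0 // -exprD (_ : q.+1 + m.*2 = 2 * m.*2 + 2)%N; last by clear; lia.
by rewrite exprD w3 mul1r => E2; rewrite E2 eqxx in w2.
Qed.

Lemma isO_inSec w X : w != 0 -> isO X -> inSec w X = false.
Proof.
move=> w0 /and3P[_ /eqP Q _]; rewrite /inSec Q expr0n gtn_eqF ?muln_gt0 ?m_gt0 //.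
by rewrite eq_sym expf_eq0 (negPf w0) andbF.
Qed.

Lemma isO_inExt w X : w != 0 -> isO X -> inExt w X = false.
Proof.
move=> w0 /and3P[_ /eqP Q _]; rewrite /inExt Q expr0n gtn_eqF ?muln_gt0 ?m_gt0 //.
by rewrite eq_sym expf_eq0 (negPf w0) andbF.
Qed.

Definition inT w w' X := [|| isO X, inSec w X | inExt w' X].

Lemma inTE w w' X :
  w ^+ (2 * q.+1) = 1 -> w ^+ 2 != 1 -> w' ^+ (2 * m.*2) = 1 -> w' ^+ 2 != 1 ->
  (inT w w' X : nat) = (isO X + inSec w X + inExt w' X)%N.
Proof.
move=> w1 w2 v1 v2.
have w0 : w != 0 by apply: expf1_neq0 w1.
have v0 : w' != 0 by apply: expf1_neq0 v1; rewrite muln_gt0 double_gt0 m_gt0.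
rewrite /inT; have [O|O] := boolP (isO X); first by rewrite isO_inSec // isO_inExt.
have [S|S] := boolP (inSec w X) => //=.
by have [E|//] := boolP (inExt w' X); case: (inSec_inExt_disjoint w1 w2 v1 v2 S E).
Qed.

Lemma plane_count_T w w' P :
  w ^+ (2 * q.+1) = 1 -> w ^+ 2 != 1 -> w' ^+ (2 * m.*2) = 1 -> w' ^+ 2 != 1 -> P != 0 ->
  #[X | (polar P X == 0) && inT w w' X]
  = (r * (q ^ 3 + 1) + n * r * inT ((-1) ^+ m * w)%R ((-1) ^+ m.+1 * w')%R P)%N.
Proof.
move=> w1 w2 v1 v2 P0.
have SP := plane_count_S w1 w2 P0.
have EP := plane_count_E v1 v2 P0.
rewrite inTE ?expr_signM //; try by rewrite expr_signM_even // mul2n odd_double.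
transitivity (#[X | (polar P X == 0) && isO X] + #[X | (polar P X == 0) && inSec w X]
   + #[X | (polar P X == 0) && inExt w' X])%N.
  rewrite -!big_split /=; apply: eq_bigr => X _.
  by case: (polar P X == 0); rewrite //= inTE.
rewrite count_O /isO P0 /=; move: SP EP.
move: (\sum_(t : T2 | _) _)%N #[X | _ && inSec w X] #[X | _ && inExt w' X] => z a b.
move: (_ && _ : bool) (inSec _ P) (inExt _ P) => o s e SP EP.
apply: (@addnI (m * n * (r * o) + m.+1 * z)).
have E : (m * n * (r * o) + m.+1 * z + (r * (q ^ 3 + 1) + n * r * (o + s + e))
  = m * (r * r + z) + n * r * s + (m.+1 * (r * n.+1 + n * (r * o)) + n * r * e) + z)%N.
  by rewrite -addnn; ring.
by rewrite E -SP -EP; clear; lia.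
Qed.

Implicit Types (D : pred T4).

(** * From vectors to points *)

Definition c4 X : 'cV[F]_4 := vec4 X.1.1 X.1.2 X.2.1 X.2.2.

Definition d4 (v : 'cV[F]_4) : T4 := ((Defs.X 1 v, Defs.X 2 v), (Defs.X 3 v, Defs.X 4 v)).

Lemma d4K : cancel d4 c4.
Proof.
move=> v; apply/colP => i; rewrite !mxE /d4 /Defs.X /=.
by case: i => [[|[|[|[|i]]]] Hi] //=; congr (v _ _); apply/val_inj; rewrite /= inordK.
Qed.

Lemma c4K : cancel c4 d4.
Proof. by move=> [[? ?] [? ?]]; rewrite /d4 /Defs.X !mxE !inordK. Qed.

Lemma c4_scale a X : c4 (scale4 a X) = a *: c4 X.
Proof.
by apply/colP => i; rewrite !mxE /=; case: i => [[|[|[|[|i]]]] Hi] //=; rewrite mulr0.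
Qed.

Lemma c4_0 : c4 0 = 0.
Proof. by apply/colP => i; rewrite !mxE; case: i => [[|[|[|[|i]]]] Hi]. Qed.

Lemma c4_eq0 X : (c4 X == 0) = (X == 0).
Proof. by rewrite -c4_0 (inj_eq (can_inj c4K)). Qed.

Lemma coord_c4 X : [/\ Defs.X 1 (c4 X) = X.1.1, Defs.X 2 (c4 X) = X.1.2,
  Defs.X 3 (c4 X) = X.2.1 & Defs.X 4 (c4 X) = X.2.2].
Proof. by case: X (c4K X) => [[? ?] [? ?]] [-> -> -> ->]. Qed.

Lemma Hform_c4 X : Hform q (c4 X) = herm q X.
Proof. by rewrite /Hform; have [-> -> -> ->] := coord_c4 X; rewrite /herm !normE. Qed.

Lemma Fform_c4 c X : Fform q c (c4 X) = herm q X - c * quad X ^+ m.+1.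
Proof.
rewrite /Fform Hform_c4; have [-> -> -> ->] := coord_c4 X.
by rewrite /quad -doubleS doubleK.
Qed.

Definition scale_invariant D := forall a X, a != 0 -> D (scale4 a X) = D X.

Definition locus D : {set {set 'cV[F]_4}} := [set pt (c4 X) | X : T4 & (X != 0) && D X].

Lemma eq_locus D D' : (forall X, X != 0 -> D X = D' X) -> locus D = locus D'.
Proof.
move=> DD; apply/setP => P.
apply/imsetP/imsetP => -[X]; rewrite !inE => /andP[X0 DX] ->; exists X => //; rewrite inE X0 /=.
  by rewrite -DD.
by rewrite DD.
Qed.

Lemma zero_locusE f : zero_locus f = locus (fun X => f (c4 X) == 0).
Proof.
apply/setP => P; apply/imsetP/imsetP => [[v]|[X]]; rewrite inE => /andP[v0 fv] ->.
  by exists (d4 v); rewrite ?inE d4K // -c4_eq0 d4K v0.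
by exists (c4 X) => //; rewrite inE c4_eq0 v0.
Qed.

Lemma pt_scale a X : a != 0 -> pt (c4 (scale4 a X)) = pt (c4 X).
Proof.
move=> a0; apply/setP => v; apply/imsetP/imsetP => -[b _ ->]; rewrite c4_scale.
  by exists (b * a); rewrite ?scalerA.
by exists (b / a); rewrite ?scalerA ?divfK.
Qed.

Lemma pt_eq X Y : Y != 0 -> pt (c4 X) = pt (c4 Y) -> exists2 a, a != 0 & Y = scale4 a X.
Proof.
move=> Y0 E; have : c4 Y \in pt (c4 X) by rewrite E; apply/imsetP; exists 1; rewrite ?scale1r.
case/imsetP => a _ ; rewrite -c4_scale => /(can_inj c4K) YE; exists a => //.
apply: contraNneq Y0 => a0; rewrite YE a0 /scale4 !mul0r.
by rewrite !xpair_eqE !eqxx.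
Qed.

Lemma mem_locus D X : scale_invariant D -> X != 0 -> (pt (c4 X) \in locus D) = D X.
Proof.
move=> sD X0; apply/imsetP/idP => [[Y]|DX]; last by exists X => //; rewrite inE X0.
by rewrite inE => /andP[Y0 DY] /(pt_eq Y0)[a a0 YE]; rewrite YE sD in DY.
Qed.

Lemma card_locus D : scale_invariant D -> (r * #|locus D| = \sum_(X : T4) ((X != 0) && D X)%R)%N.
Proof.
move=> sD; rewrite sum_bool_card -[RHS]sum1_card (partition_big_imset (fun X => pt (c4 X))) /=.
rewrite mulnC -sum_nat_const; apply: eq_bigr => P /imsetP[X]; rewrite inE => /andP[X0 DX] ->.
rewrite -[r]muln1 -sum_nz_const !sum1dep_card.
have inj : injective (fun a => scale4 a X).
  move=> a b [e1 e2 e3 e4]; move: X0; case: X e1 e2 e3 e4 {DX} => [[x1 x2] [x3 x4]] /= e1 e2 e3 e4.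
  rewrite !xpair_eqE !negb_and -!orbA => /or4P[] x0.
  - exact: (mulIf x0) e1.
  - exact: (mulIf x0) e2.
  - exact: (mulIf x0) e3.
  - exact: (mulIf x0) e4.
have s0 a : (scale4 a X == 0) = (a == 0).
  by rewrite -(inj_eq inj) [in RHS](_ : scale4 0 X = 0) // /scale4 !mul0r.
rewrite -[LHS](card_imset _ inj); apply: eq_card => Y; apply/imsetP/idP => [[a]|].
  by rewrite !inE => a0 ->; rewrite s0 a0 sD // DX pt_scale // eqxx.
rewrite !inE => /andP[/andP[Y0 DY] /eqP/esym/(pt_eq Y0)[a a0 ->]]; exists a => //.
by rewrite inE.
Qed.

Lemma locusU D D' : locus D :|: locus D' = locus (fun X => D X || D' X).
Proof.
apply/setP => P; rewrite inE; apply/orP/imsetP => [[]/imsetP[X]|[X]]; rewrite inE => /andP[X0 DX] ->.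
- by exists X; rewrite // inE X0 DX.
- by exists X; rewrite // inE X0 DX orbT.
by case/orP: DX => DX; [left | right]; apply/imsetP; exists X; rewrite // inE X0.
Qed.

Lemma locusI D D' : scale_invariant D' -> locus D :&: locus D' = locus (fun X => D X && D' X).
Proof.
move=> sD'; apply/setP => P; rewrite inE; apply/andP/imsetP => [[/imsetP[X]]|[X]]; rewrite inE.
  by move=> /andP[X0 DX] ->; rewrite mem_locus // => D'X; exists X => //; rewrite inE X0 DX.
by move=> /and3P[X0 DX D'X] ->; rewrite (mem_locus sD') // D'X; split=> //; apply: imset_f; rewrite inE X0.
Qed.

Lemma locusD D D' : scale_invariant D' -> locus D :\: locus D' = locus (fun X => ~~ D' X && D X).
Proof.
move=> sD'; apply/setP => P; rewrite inE; apply/andP/imsetP => [[nP /imsetP[X]]|[X]]; rewrite inE.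
  by move=> /andP[X0 DX] PE; exists X => //; rewrite inE X0 DX andbT; move: nP; rewrite PE mem_locus.
by move=> /and3P[X0 D'X DX] ->; rewrite (mem_locus sD') //; split=> //; apply: imset_f; rewrite inE X0.
Qed.

Lemma locus_PG D : locus D \subset PG F.
Proof.
apply/subsetP => P /imsetP[X]; rewrite inE => /andP[X0 _] ->.
by apply: imset_f; rewrite inE c4_eq0.
Qed.

Lemma polar_inv P : scale_invariant (fun X => polar P X == 0).
Proof. by move=> a X a0; rewrite polar_scale mulf_eq0 (negPf a0). Qed.

Lemma plane_locus (u : 'rV[F]_4) : u != 0 ->
  exists2 P, P != 0 & plane u = locus (fun X => polar P X == 0).
Proof.
move=> u0; pose P : T4 := ((u 0 (inord 3), - u 0 (inord 2)), (- u 0 (inord 1), u 0 (inord 0))).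
exists P.
  apply: contraNneq u0 => /eqP; rewrite !xpair_eqE /= !oppr_eq0.
  move=> /andP[/andP[/eqP e3 /eqP e2] /andP[/eqP e1 /eqP e0]].
  apply/eqP/rowP => i; rewrite mxE.
  case: i => [[|[|[|[|i]]]] Hi] //; [rewrite -e0 | rewrite -e1 | rewrite -e2 | rewrite -e3];
    by congr (u _ _); apply/val_inj; rewrite /= inordK.
rewrite /plane zero_locusE; apply: eq_locus => X _; congr (_ == 0).
rewrite mxE !big_ord_recl big_ord0 /polar /= !mxE /=.
have e k (Hk : (k < 4)%N) (i : 'I_4) : val i = k -> u 0 i = u 0 (inord k).
  by move=> ik; congr (u _ _); apply/val_inj; rewrite /= inordK.
rewrite (e 0%N _ ord0) // (e 1%N _ (lift ord0 ord0)) // (e 2 _ (lift ord0 (lift ord0 ord0))) //.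
rewrite (e 3 _ (lift ord0 (lift ord0 (lift ord0 ord0)))) //.
by ring.
Qed.

Lemma locus_plane P : P != 0 -> locus (fun X => polar P X == 0) \in planes F.
Proof.
move=> P0; pose u : 'rV[F]_4 := \row_i [:: P.2.2; - P.2.1; - P.1.2; P.1.1]`_i.
apply/imsetP; exists u.
  rewrite inE; apply: contraNneq P0 => /rowP u0.
  have := (u0 (inord 0), u0 (inord 1), u0 (inord 2), u0 (inord 3)).
  rewrite !mxE !inordK //= => -[[[e0 /eqP e1] /eqP e2] e3]; move: e1 e2.
  rewrite !oppr_eq0 => /eqP e1 /eqP e2.
  by case: P e0 e1 e2 e3 {u u0} => [[? ?] [? ?]] /= -> -> -> ->.
rewrite /plane zero_locusE; apply: eq_locus => X _; congr (_ == 0).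
by rewrite mxE !big_ord_recl big_ord0 /polar /= !mxE /=; ring.
Qed.

Lemma herm_scale a X : herm q (scale4 a X) = N a * herm q X.
Proof. by rewrite /herm /= !barM; ring. Qed.

Lemma scale4_eq0 a X : a != 0 -> (scale4 a X == 0) = (X == 0).
Proof. by move=> a0; rewrite !xpair_eqE /= !mulf_eq0 (negPf a0). Qed.

Lemma isO_inv : scale_invariant isO.
Proof.
move=> a X a0; rewrite /isO scale4_eq0 // quad_scale herm_scale !mulf_eq0 !expf_eq0 ?bar_eq0.
by rewrite (negPf a0).
Qed.

Lemma quad_half_scale a X : a != 0 -> quad (scale4 a X) ^+ halfexp = quad X ^+ halfexp.
Proof.
move=> a0; rewrite quad_scale exprMn -exprM halfexp_mul.
suff -> : a ^+ #|F|.-1 = 1 by rewrite mul1r.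
by apply: (mulfI a0); rewrite -exprS prednK ?expf_card ?mulr1 // ltnW // finNzRing_gt1.
Qed.

Lemma herm_eq_scale a b X : a != 0 ->
  (herm q (scale4 a X) == b * quad (scale4 a X) ^+ m.+1) = (herm q X == b * quad X ^+ m.+1).
Proof.
move=> a0; rewrite herm_scale quad_scale exprMn exprAC half_norm mulrCA.
by rewrite (inj_eq (mulfI _)) // norm_eq0.
Qed.

Lemma inSec_inv w : scale_invariant (inSec w).
Proof. by move=> a X a0; rewrite /inSec quad_half_scale // herm_eq_scale. Qed.

Lemma inExt_inv w : scale_invariant (inExt w).
Proof. by move=> a X a0; rewrite /inExt quad_half_scale // herm_eq_scale. Qed.

Lemma inT_inv w w' : scale_invariant (inT w w').
Proof. by move=> a X a0; rewrite /inT isO_inv // inSec_inv // inExt_inv. Qed.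

Lemma class_neq0 a X : a != 0 -> quad X ^+ halfexp == a -> quad X != 0.
Proof.
move=> a0; apply: contraTneq => ->.
by rewrite expr0n gtn_eqF ?muln_gt0 ?m_gt0 // eq_sym.
Qed.

Lemma inSec_neq0 w X : w != 0 -> inSec w X -> X != 0.
Proof.
move=> w0 /andP[/(class_neq0 (expf_neq0 _ w0)) Q0 _]; apply: contraNneq Q0 => ->.
by rewrite /quad /= !mul0r subrr.
Qed.

Lemma inExt_neq0 w X : w != 0 -> inExt w X -> X != 0.
Proof.
move=> w0 /andP[/(class_neq0 (expf_neq0 _ w0)) Q0 _]; apply: contraNneq Q0 => ->.
by rewrite /quad /= !mul0r subrr.
Qed.

Lemma card_locus_plane w w' P :
  w ^+ (2 * q.+1) = 1 -> w ^+ 2 != 1 -> w' ^+ (2 * m.*2) = 1 -> w' ^+ 2 != 1 -> P != 0 ->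
  #|locus (inT w w') :&: locus (fun X => polar P X == 0)|
  = (q ^ 3 + 1 + n * inT ((-1) ^+ m * w)%R ((-1) ^+ m.+1 * w')%R P)%N.
Proof.
move=> w1 w2 v1 v2 P0; have r0 : (0 < r)%N by rewrite !muln_gt0 m_gt0.
have w0 : w != 0 by apply: expf1_neq0 w1.
have v0 : w' != 0 by apply: expf1_neq0 v1; rewrite muln_gt0 double_gt0 m_gt0.
rewrite locusI; last exact: polar_inv.
apply/eqP; rewrite -(eqn_pmul2l r0) card_locus; last first.
  by move=> a X a0; rewrite inT_inv // (polar_inv P).
apply/eqP; transitivity (\sum_X ((polar P X == 0) && inT w w' X)%R)%N.
  apply: eq_bigr => X _; congr nat_of_bool.
  have [T|T] := boolP (inT w w' X); rewrite ?andbF //= andbT.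
  suff -> : X != 0 by [].
  move: T; rewrite /inT => /or3P[/and3P[]//||]; [exact: inSec_neq0 | exact: inExt_neq0].
rewrite (plane_count_T w1 w2 v1 v2 P0).
by move: (inT _ _ P : nat) => b; rewrite mulnDr; lia.
Qed.

Lemma quasi_Hermitian_locus w w' :
  w ^+ (2 * q.+1) = 1 -> w ^+ 2 != 1 -> w' ^+ (2 * m.*2) = 1 -> w' ^+ 2 != 1 ->
  quasi_Hermitian q (locus (inT w w')).
Proof.
move=> w1 w2 v1 v2; split; first exact: locus_PG.
have w0 : w != 0 by apply: expf1_neq0 w1.
have v0 : w' != 0 by apply: expf1_neq0 v1; rewrite muln_gt0 double_gt0 m_gt0.
move=> k; rewrite !inE; apply/imageP/orP => [[pi /imsetP[u]]|].
  rewrite inE => u0 -> ->; have [P P0 ->] := plane_locus u0.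
  by rewrite card_locus_plane //; case: (inT _ _ P); [right | left]; apply/eqP; lia.
have count P : P != 0 -> exists2 pi, pi \in planes F & #|locus (inT w w') :&: pi| =
    (q ^ 3 + 1 + n * inT ((-1) ^+ m * w)%R ((-1) ^+ m.+1 * w')%R P)%N.
  by move=> P0; exists (locus (fun X => polar P X == 0)); [exact: locus_plane | exact: card_locus_plane].
have nz3 (a : F) : (0, a, (0, 0)) == 0 :> T4 = (a == 0) by rewrite !xpair_eqE !eqxx /= !andbT.
case=> /eqP->.
  (* This P has [quad] 0 and [herm] -1, hence lies in none of the three types: the smaller number
     occurs. *)
  have P0 : (0, 1, (0, 0)) != 0 :> T4 by rewrite nz3 oner_eq0.
  have [pi pi_plane E] := count _ P0; exists pi; rewrite // E.
  have s0 k' (x : F) : x != 0 -> (-1) ^+ k' * x != 0 by move=> x0; rewrite mulf_neq0 ?signr_eq0.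
  have Q0 : quad (0, 1, (0, 0)) = 0 :> F by rewrite /quad /= mul0r mulr0 subrr.
  rewrite (_ : inT _ _ _ = false) ?muln0 ?addn0 //; apply: negbTE.
  rewrite !negb_or; apply/and3P; split.
  - rewrite /isO !negb_and /herm /= bar0 bar1 !(mul0r, mulr0, subr0, add0r, sub0r, mulr1).
    by rewrite oppr_eq0 oner_eq0 !orbT.
  - by apply/negP => /andP[/(class_neq0 (expf_neq0 _ (s0 _ _ w0)))]; rewrite Q0 eqxx.
  - by apply/negP => /andP[/(class_neq0 (expf_neq0 _ (s0 _ _ v0)))]; rewrite Q0 eqxx.
(* The point (0,0,0,1) of O realises the larger number. *)
have P0 : (0, 0, (0, 1)) != 0 :> T4 by rewrite !xpair_eqE oner_eq0 !andbF.
have [pi pi_plane E] := count _ P0; exists pi; rewrite // E.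
rewrite /inT /isO P0 /quad /herm /= bar0 !(mul0r, mulr0, subr0, addr0) eqxx /=.
by lia.
Qed.

(* Compare both sides of [herm q X = g * quad X ^+ m.+1] with their conjugates. *)
Lemma form_locus a g X :
  X != 0 -> bar g = a * g -> a ^+ 2 = 1 -> g != 0 ->
  (herm q X == g * quad X ^+ m.+1)
  = isO X || (quad X ^+ halfexp == a) && (herm q X == g * quad X ^+ m.+1).
Proof.
move=> X0 bg a2 g0; rewrite /isO X0 /=.
have [Q0|Q0] := eqVneq (quad X) 0.
  rewrite Q0 expr0n /= mulr0; case: eqP => //= _; rewrite andbF //.
apply/idP/idP => [/eqP E|/andP[]//]; rewrite E eqxx andbT /=.
have : bar (herm q X) = herm q X by rewrite /herm !(barD, barN, barM, barK); ring.
rewrite E barM bg (_ : bar (quad X ^+ m.+1) = quad X ^+ halfexp * quad X ^+ m.+1); last first.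
  by rewrite /frob -exprM -exprD; congr (_ ^+ _); rewrite /halfexp; clear; lia.
move=> E2; have : a * quad X ^+ halfexp = 1.
  apply: (mulIf (mulf_neq0 g0 (expf_neq0 m.+1 Q0))); rewrite mul1r -[RHS]E2; ring.
move=> E3; apply/eqP; apply: (mulfI (expf1_neq0 (ltn0Sn 1) a2)).
by rewrite E3 -expr2.
Qed.

(** * The orbits of K on the Hermitian surface *)

Local Notation kframe s' s X := (frame (frob2 q s') (frob2 q s) s' s X).

Lemma det2_frob s t : det2 (frob2 q s) (frob2 q t) = bar (det2 s t).
Proof. by rewrite /det2 /= -!barM -barN -barD. Qed.

Definition conj4 X : T4 := ((bar X.1.1, bar X.2.1), (bar X.1.2, bar X.2.2)).

Lemma bar_ev s t X : bar (h s t X) = h t s (conj4 X).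
Proof. by rewrite /ev /= !(barD, barN, barM, barK); ring. Qed.

Lemma conj4_frame s' s X : conj4 (kframe s' s X) = kframe s' s (conj4 X).
Proof. by rewrite /frame /conj4 /= !bar_ev. Qed.

Lemma herm_polar X : herm q X = polar X (conj4 X).
Proof. by rewrite /herm /polar /=; ring. Qed.

Lemma quad_kframe s' s X : det2 s' s = 1 -> quad (kframe s' s X) = quad X.
Proof. by move=> d; apply: quad_frame; rewrite ?det2_frob d ?bar1. Qed.

Lemma herm_kframe s' s X : det2 s' s = 1 -> herm q (kframe s' s X) = herm q X.
Proof.
move=> d; rewrite !herm_polar conj4_frame.
by apply: polar_frame; rewrite ?det2_frob d ?bar1.
Qed.

(** The form [polar] pairs coordinates as in the adjugate matrix, so a row (a, b) of A appears as
    the vector (- b, a). This makes K act by isometries of [quad]. *)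
Lemma Kmx_kframe (A : 'M[F]_2) X :
  Kmx q A *m c4 X = c4 (kframe (- A 0 1, A 0 0) (- A 1 1, A 1 0) X).
Proof.
pose B k l := A (inord k) (inord l).
have EB i j : A i j = B (val i) (val j) by rewrite /B !inord_val.
apply/colP => i; rewrite mxE !big_ord_recl big_ord0 addr0 !mxE !EB /=.
by case: i => [[|[|[|[|i]]]] Hi] //=; rewrite /ev /divn /modn /= -!/(frob q _) !barN; ring.
Qed.

Lemma Kmx_mul (A B : 'M[F]_2) : Kmx q (A *m B) = Kmx q A *m Kmx q B.
Proof.
pose f (M : 'M[F]_2) := map_mx (fun a => a ^+ q) M.
transitivity (tensmx (f A *m f B) (A *m B)); last first.
  exact: (esym (@tensmx_mul F _ _ _ _ _ _ (f A) A (f B) B)).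
rewrite /Kmx; suff -> : map_mx (fun a => a ^+ q) (A *m B) = f A *m f B by [].
apply/matrixP => i j.
by rewrite !mxE !big_ord_recl !big_ord0 !addr0 -!/(frob q _) barD !barM !mxE.
Qed.

Lemma Kmx1 : Kmx q (1%:M : 'M[F]_2) = 1%:M.
Proof.
apply/matrixP => i j; rewrite !mxE.
have -> : (i == j) = (mxtens_unindex (i : 'I_(2 * 2)) == mxtens_unindex (j : 'I_(2 * 2))).
  by rewrite (inj_eq (can_inj (@mxtens_unindexK 2 2))).
rewrite -pair_eqE /=; case: (_ == _) (_ == _) => [] []; rewrite ?expr1n ?expr0n ?mulr0 ?mul0r ?mulr1 //.
Qed.

Lemma projectivity_pt (M : 'M[F]_4) v : projectivity M (pt v) = pt (M *m v).
Proof.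
apply/setP => y; apply/imsetP/imsetP => [[x /imsetP[a _ ->] ->]|[a _ ->]].
  by exists a => //; rewrite -scalemxAr.
by exists (a *: v); rewrite -?scalemxAr //; apply/imsetP; exists a.
Qed.

Definition krel X Y := pt (c4 Y) \in Korbit q (pt (c4 X)).

Lemma krelP X Y : reflect (exists2 A : 'M[F]_2, \det A = 1 & pt (Kmx q A *m c4 X) = pt (c4 Y)) (krel X Y).
Proof.
apply: (iffP imsetP) => [[A]|[A dA E]].
  by rewrite inE projectivity_pt => /eqP dA E; exists A.
by exists A; rewrite ?inE ?dA // projectivity_pt.
Qed.

Lemma pt_mulmx (M : 'M[F]_4) u v : pt u = pt v -> pt (M *m u) = pt (M *m v).
Proof. by rewrite -!projectivity_pt => ->. Qed.

Lemma krel_trans X Y Z : krel X Y -> krel Y Z -> krel X Z.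
Proof.
move=> /krelP[A dA EA] /krelP[B dB EB]; apply/krelP; exists (B *m A).
  by rewrite det_mulmx dA dB mulr1.
by rewrite Kmx_mul -mulmxA (pt_mulmx _ EA).
Qed.

Lemma krel_sym X Y : krel X Y -> krel Y X.
Proof.
move=> /krelP[A dA EA]; apply/krelP; exists (invmx A); first by rewrite det_inv dA invr1.
have uA : A \in unitmx by rewrite unitmxE dA unitr1.
by rewrite -(pt_mulmx _ EA) mulmxA -Kmx_mul mulVmx // Kmx1 mul1mx.
Qed.

Lemma det_mx22 (A : 'M[F]_2) : \det A = A 0 0 * A 1 1 - A 0 1 * A 1 0.
Proof.
have z1 : 1 = lift ord0 ord0 :> 'I_2 by apply/val_inj.
have l1 : lift 1 0 = 0 :> 'I_2 by apply/val_inj.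
rewrite (expand_det_row _ 0) !big_ord_recl big_ord0 addr0 /cofactor !det_mx11 !mxE -z1 l1 /=.
by rewrite expr0 expr1 mul1r mulN1r mulrN.
Qed.

Lemma krel_frame s' s X a : det2 s' s = 1 -> a != 0 -> krel X (scale4 a (kframe s' s X)).
Proof.
move=> d a0; apply/krelP.
exists (\matrix_(i, j) (if i == 0 then if j == 0 then s'.2 else - s'.1
                       else if j == 0 then s.2 else - s.1)).
  by rewrite det_mx22 !mxE /= -d /det2; ring.
rewrite pt_scale // Kmx_kframe !mxE /= !opprK.
by case: (s') (s) => [? ?] [? ?].
Qed.

Lemma Korbit_inv D X : scale_invariant D -> (forall s' s Y, det2 s' s = 1 -> D (kframe s' s Y) = D Y) ->
  X != 0 -> D X -> Korbit q (pt (c4 X)) \subset locus D.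
Proof.
move=> sD kD X0 DX; apply/subsetP => P /imsetP[A]; rewrite inE => /eqP dA ->.
have d : det2 (- A 0 1, A 0 0) (- A 1 1, A 1 0) = 1.
  by rewrite -dA det_mx22 /det2 /=; ring.
rewrite projectivity_pt Kmx_kframe mem_locus ?kD //.
by rewrite frame_eq0 ?det2_frob ?d ?bar1.
Qed.

Definition diag4 x y : T4 := ((x, 0), (0, y)).

Definition anti4 x y : T4 := ((0, x), (y, 0)).

(** The matrix diag(a, 1/a) multiplies x1 by N a and x4 by its inverse, hence their ratio by the
    square of N a. *)
Lemma krel_diag a z : a != 0 -> krel (diag4 z 1) (diag4 (a ^+ (4 * m.+1) * z) 1).
Proof.
move=> a0; have Na0 : N a != 0 by rewrite norm_eq0.
have d : det2 (0, a) (- a^-1, 0) = 1 by rewrite /det2 /= mul0r sub0r mulrN opprK divff.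
have -> : diag4 (a ^+ (4 * m.+1) * z) 1 = scale4 (N a) (kframe (0, a) (- a^-1, 0) (diag4 z 1)).
  have -> : a ^+ (4 * m.+1) = N a ^+ 2.
    by rewrite normE -exprM; congr (_ ^+ _); clear; lia.
  rewrite /scale4 /diag4 /frame /ev /= bar0 barN barV.
  by congr ((_, _), (_, _)); field; rewrite ?bar_eq0 ?a0.
exact: krel_frame.
Qed.

Lemma krel_diag_swap z : z != 0 -> krel (diag4 z 1) (diag4 z^-1 1).
Proof.
move=> z0; have d : det2 (-1, 0) (0, -1) = 1 :> F by rewrite /det2 /=; ring.
have -> : diag4 z^-1 1 = scale4 z^-1 (kframe (-1, 0) (0, -1) (diag4 z 1)).
  rewrite /scale4 /diag4 /frame /ev /= bar0 barN bar1.
  by congr ((_, _), (_, _)); field.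
by apply: krel_frame; rewrite ?invr_eq0.
Qed.

(** The same diagonal matrix multiplies x2 by [bar a / a] and x3 by its inverse, hence their ratio
    by the square of that quotient. *)
Lemma krel_anti a z : a != 0 -> krel (anti4 z 1) (anti4 (a ^+ (4 * m) * z) 1).
Proof.
move=> a0; have ba0 : bar a != 0 by rewrite bar_eq0.
have d : det2 (0, a) (- a^-1, 0) = 1 by rewrite /det2 /= mul0r sub0r mulrN opprK divff.
have -> : anti4 (a ^+ (4 * m) * z) 1 = scale4 (bar a / a) (kframe (0, a) (- a^-1, 0) (anti4 z 1)).
  have -> : a ^+ (4 * m) = (bar a / a) ^+ 2.
    by rewrite /frob [a ^+ q]exprS [a * _]mulrC mulfK // -exprM; congr (_ ^+ _); clear; lia.
  rewrite /scale4 /anti4 /frame /ev /= bar0 barN barV.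
  by congr ((_, _), (_, _)); field; rewrite ?ba0 ?a0.
by apply: krel_frame; rewrite ?mulf_neq0 ?invr_eq0.
Qed.

Lemma krel_anti_swap z : z != 0 -> krel (anti4 z 1) (anti4 z^-1 1).
Proof.
move=> z0; have d : det2 (-1, 0) (0, -1) = 1 :> F by rewrite /det2 /=; ring.
have -> : anti4 z^-1 1 = scale4 (- z^-1) (kframe (-1, 0) (0, -1) (anti4 z 1)).
  rewrite /scale4 /anti4 /frame /ev /= bar0 barN bar1.
  by congr ((_, _), (_, _)); field.
by apply: krel_frame; rewrite ?oppr_eq0 ?invr_eq0.
Qed.

(** The diagonal matrices alone reach only half of the admissible ratios: (z'/z)^f is 1 or -1. If it
    is -1, then (z' z)^f = 1 because z^(2f) = -1, so replacing z by its inverse, which the swap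
    realises, reaches the other half. *)
Lemma ratio_solve (e f : nat) z z' : (4 * e * f = #|F|.-1)%N ->
  z != 0 -> z' != 0 -> z ^+ (2 * f) = -1 -> z' ^+ (2 * f) = -1 ->
  exists2 a, a != 0 & a ^+ (4 * e) * z = z' \/ a ^+ (4 * e) * z^-1 = z'.
Proof.
move=> ef z0 z0' zf zf'.
have e0 : (0 < 4 * e)%N.
  by move: ef; rewrite lt0n; case: (4 * e)%N => // /esym; rewrite card_pred; have := m_gt0; lia.
have nz a y : y != 0 -> a ^+ (4 * e) = y -> a != 0.
  by move=> y0 ay; apply: contraNneq y0 => a0; rewrite -ay a0 expr0n gtn_eqF.
have [u1|u1] := eqVneq ((z' / z) ^+ f) 1.
  have [a aE] := expf_solvable ef u1; exists a; last by left; rewrite aE divfK.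
  by apply: nz aE; rewrite mulf_neq0 ?invr_eq0.
have u2 : (z' / z) ^+ f = -1.
  have : ((z' / z) ^+ f) ^+ 2 = 1 by rewrite -exprM mulnC expr_div_n zf zf' divff // oppr_eq0 oner_eq0.
  by move/eqP; rewrite sqrf_eq1 (negPf u1) => /eqP.
have u3 : (z' * z) ^+ f = 1.
  have -> : z' * z = z' / z * z ^+ 2 by field.
  by rewrite exprMn u2 -exprM zf mulrNN mulr1.
have [a aE] := expf_solvable ef u3; exists a; last by right; rewrite aE mulfK.
by apply: nz aE; rewrite mulf_neq0.
Qed.


Lemma half_double (k : F) : k ^+ m.*2 = (k ^+ m) ^+ 2.
Proof. by rewrite -exprM muln2. Qed.

Lemma neg_neq a : a != 0 -> - a != a.
Proof.
move=> a0; rewrite eq_sym -subr_eq0 opprK -mulr2n -mulr_natl mulf_neq0 //.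
exact: two_neq0.
Qed.

(* The eigenvalue k below is skew, so t and t' = conj (K t) are eigenvectors for k
   and -k, and [h t t' X = h t' t X = 0]. *)
Lemma krel_Sec_diag (i : F) X : i ^+ 2 = -1 -> inSec i X ->
  exists z, [/\ z != 0, z ^+ (2 * m) = -1 & krel X (diag4 z 1)].
Proof.
move=> i2 /andP[/eqP Qi /eqP Hi].
have i0 : i != 0 by rewrite -sqrf_eq0 i2 oppr_eq0 oner_eq0.
have iV : i^-1 = - i by apply: (mulfI i0); rewrite divff // mulrN -expr2 i2 opprK.
have {}Hi : herm q X = 0 by rewrite Hi iV subrr mul0r.
have Q0 : quad X != 0 by apply: (@class_neq0 _ _ (expf_neq0 q.+1 i0)); rewrite Qi.
set g := quad X ^+ m.+1; have g0 : g != 0 by rewrite expf_neq0.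
pose k := i * g; have k0 : k != 0 by rewrite mulf_neq0.
have bk : bar k = - k.
  rewrite bar_coset -half_double exprMn -exprM (_ : m.+1 * m.*2 = halfexp)%N; last first.
    by rewrite /halfexp; clear; lia.
  rewrite Qi -exprD (_ : m.*2 + q.+1 = 2 * q)%N; last by clear; lia.
  by rewrite exprM i2 -signr_odd /= odd_double mulrN1.
have gQ : g ^+ 2 = N (quad X) by exact: half_norm.
have kQ : k ^+ 2 != N (quad X) by rewrite -gQ exprMn i2 mulN1r neg_neq ?expf_neq0.
have kE : k ^+ 2 + k * herm q X + N (quad X) = 0.
  by rewrite -gQ Hi exprMn i2 mulr0 addr0 mulN1r addNr.
have [t t0] := eigen_exists kQ kE.
set k1 := t.1 * X.1.2 - t.2 * X.1.1; set k2 := t.1 * X.2.2 - t.2 * X.2.1 => -[e1 e2].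
have k1E : k1 = t.1 * X.1.2 - t.2 * X.1.1 by [].
have k2E : k2 = t.1 * X.2.2 - t.2 * X.2.1 by [].
clearbody k1 k2; pose t' : T2 := (bar k1, bar k2).
have b1 : bar k1 * X.1.2 - bar k2 * X.1.1 = - k * bar t.1.
  by rewrite -bk -barM -e1 barD barN !barM !barK.
have b2 : bar k1 * X.2.2 - bar k2 * X.2.1 = - k * bar t.2.
  by rewrite -bk -barM -e2 barD barN !barM !barK.
have h1 : h t' t X = 0 by rewrite /ev /= !barK k1E k2E; ring.
have h2 : h t t' X = 0.
  transitivity (bar t.1 * (bar k1 * X.2.2 - bar k2 * X.2.1) - bar t.2 * (bar k1 * X.1.2 - bar k2 * X.1.1)).
    by rewrite /ev /=; ring.
  by rewrite b1 b2; ring.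
(* If t' were a multiple mu t, the eigenvalue k would be N mu, fixed by conjugation, although it is
   skew and nonzero. *)
set d := det2 t' t; have d0 : d != 0.
  apply/eqP => d0; have [|mu [m1 m2]] := @det2_eq0 t' t t0; first by rewrite -[RHS]oppr0 -d0 /d /det2; ring.
  have kN : k = N mu.
    have c1 : bar mu * (bar t.1 * bar X.1.2 - bar t.2 * bar X.1.1) = k * t.1.
      by rewrite -e1 -[k1](barK) -[k2](barK) m1 m2 !barM; ring.
    have c2 : bar mu * (bar t.1 * bar X.2.2 - bar t.2 * bar X.2.1) = k * t.2.
      by rewrite -e2 -[k1](barK) -[k2](barK) m1 m2 !barM; ring.
    have f1 : bar t.1 * bar X.1.2 - bar t.2 * bar X.1.1 = mu * t.1.
      by rewrite -m1 k1E barD barN !barM.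
    have f2 : bar t.1 * bar X.2.2 - bar t.2 * bar X.2.1 = mu * t.2.
      by rewrite -m2 k2E barD barN !barM.
    move: t0; rewrite nz2 => /orP[t1|t2].
      by apply: (mulIf t1); rewrite -c1 f1; ring.
    by apply: (mulIf t2); rewrite -c2 f2; ring.
  by move: bk; rewrite {1}kN bar_norm -kN => /esym/eqP; rewrite (negPf (neg_neq k0)).
pose s : T2 := (t'.1 / d, t'.2 / d).
have ds : det2 s t = 1.
  by transitivity (d / d); [rewrite /d /det2 /=; ring | rewrite divff].
have fr : kframe s t X = diag4 (h s s X) (h t t X).
  have z1 : h s t X = 0 by transitivity (bar d^-1 * h t' t X); [rewrite /ev /= !barM; ring | rewrite h1 mulr0].
  have z2 : h t s X = 0 by transitivity (d^-1 * h t t' X); [rewrite /ev /=; ring | rewrite h2 mulr0].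
  by rewrite /frame z1 z2.
move: (h s s X) (h t t X) fr => x y fr.
have xy : x * y != 0.
  by rewrite -(quad_kframe X ds) fr /quad /= mulr0 subr0 in Q0.
have [x0 y0] : x != 0 /\ y != 0 by move: xy; rewrite mulf_eq0 negb_or => /andP.
exists (x / y); split; first by rewrite mulf_neq0 ?invr_eq0.
  have : bar x * y + x * bar y = 0.
    by rewrite -[RHS]Hi -(herm_kframe X ds) fr /herm /= bar0 !mulr0 !subr0.
  have z0 : x / y != 0 by rewrite mulf_neq0 ?invr_eq0.
  move=> E; apply: (mulfI z0); rewrite mulrN1 mul2n half_double -bar_coset barM barV.
  have by0 : bar y != 0 by rewrite bar_eq0.
  apply: (mulIf (mulf_neq0 y0 by0)); rewrite mulNr; apply/eqP; rewrite -addr_eq0 -E.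
  by apply/eqP; field; rewrite ?y0 ?by0.
have -> : diag4 (x / y) 1 = scale4 y^-1 (kframe s t X).
  by rewrite fr /scale4 /diag4 /= mulr0 mulVf // mulrC.
by apply: krel_frame; rewrite ?invr_eq0.
Qed.

(* A zero t of [h t t X] gives a second zero b + a t, because herm = 0 forces
   [N y = - N y'] and so [a |-> bar a * y' + a * y] is bijective. *)
Lemma krel_Ext_anti (i : F) X : i ^+ 2 = -1 -> inExt i X ->
  exists z, [/\ z != 0, z ^+ (2 * m.+1) = -1 & krel X (anti4 z 1)].
Proof.
move=> i2 /andP[/eqP Qi /eqP Hi].
have i0 : i != 0 by rewrite -sqrf_eq0 i2 oppr_eq0 oner_eq0.
have iV : i^-1 = - i by apply: (mulfI i0); rewrite divff // mulrN -expr2 i2 opprK.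
have {}Hi : herm q X = 0 by rewrite Hi iV subrr mul0r.
have Q0 : quad X != 0 by apply: (@class_neq0 _ _ (expf_neq0 m.*2 i0)); rewrite Qi.
set g := quad X ^+ m.+1; have g0 : g != 0 by rewrite expf_neq0.
pose k := i * g; have k0 : k != 0 by rewrite mulf_neq0.
have bk : bar k = k.
  apply/eqP; rewrite bar_fixed // exprMn -exprM (_ : m.+1 * m.*2 = halfexp)%N; last first.
    by rewrite /halfexp; clear; lia.
  by rewrite Qi -expr2 -exprM mulnC exprM i2 -signr_odd odd_double.
have gQ : g ^+ 2 = N (quad X) by exact: half_norm.
have kQ : k ^+ 2 != N (quad X) by rewrite -gQ exprMn i2 mulN1r neg_neq ?expf_neq0.
have kE : k ^+ 2 + k * herm q X + N (quad X) = 0.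
  by rewrite -gQ Hi exprMn i2 mulr0 addr0 mulN1r addNr.
(* Here k is an eigenvalue fixed by conjugation, so [sum_eigen] gives r vectors t, all zeros of
   [h t t X]. *)
have [t /andP[t0 /eqP ht]] : exists t : T2, (t != 0) && (h t t X == 0).
  case: (pickP (fun t : T2 => (t != 0) && (h t t X == 0))) => [t|none]; first by exists t.
  have := sum_eigen bk kQ; rewrite kE eqxx muln1 big1 => [/esym r0|t t0].
    by move: m_gt0; rewrite lt0n; case: (m) r0 => // m'; rewrite !muln_eq0.
  by have := none t; rewrite t0 /= => ->.
set b := base2 t; have db : det2 b t = 1 by exact: det2_base.
pose y := h b t X; pose y' := h t b X.
have fr : kframe b t X = ((h b b X, y), (y', 0)) by rewrite /frame ht.
have yy : y * y' != 0.
  by move: Q0; rewrite -(quad_kframe X db) fr /quad /= mulr0 sub0r oppr_eq0.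
have [y0 y0'] : y != 0 /\ y' != 0 by move: yy; rewrite mulf_eq0 negb_or => /andP.
have Nyy : N y = - N y'.
  apply/eqP; rewrite -addr_eq0 -oppr_eq0 -Hi -(herm_kframe X db) fr.
  by rewrite /herm /= bar0 !mulr0 !add0r opprD.
have inj : injective (fun a => bar a * y' + a * y).
  move=> a1 a2 E; apply/eqP; rewrite -subr_eq0; apply: contraT => a0.
  set a := a1 - a2 in a0.
  have E0 : bar a * y' = - (a * y).
    apply/eqP; rewrite -addr_eq0 /a barD barN; move/eqP: E; rewrite -subr_eq0 => /eqP E.
    by rewrite -E; apply/eqP; ring.
  have : N (bar a * y') = N (a * y) by rewrite E0 barN mulrNN.
  have -> : N (bar a * y') = N a * N y' by rewrite barM barK; ring.
  have -> : N (a * y) = N a * N y by rewrite barM; ring.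
  have Na0 : N a != 0 by rewrite norm_eq0.
  rewrite Nyy => /(mulfI Na0) /esym /eqP; rewrite (negPf (neg_neq _)) //.
  by rewrite norm_eq0.
have [f _ fK] := injF_bij inj; pose a := f (- h b b X).
have aE : bar a * y' + a * y = - h b b X by exact: fK.
pose s := lin2 b a t.
have ds : det2 s t = 1 by rewrite -db /det2 /s /lin2 /=; ring.
have fr' : kframe s t X = anti4 y y'.
  rewrite /frame ht; congr ((_, _), (_, _)).
  - transitivity (h b b X + (bar a * y' + a * y) + N a * h t t X).
      by rewrite /y /y' /ev /s /lin2 /= !(barD, barM); ring.
    by rewrite aE ht; ring.
  - by rewrite evh_lin2 // ht mulr0 addr0.
  - transitivity (y' + a * h t t X); last by rewrite ht mulr0 addr0.
    by rewrite /y' /ev /s /lin2 /=; ring.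
exists (y / y'); split; first by rewrite mulf_neq0 ?invr_eq0.
  have ny' : N y' != 0 by rewrite norm_eq0.
  rewrite (_ : 2 * m.+1 = q.+1)%N; last by clear; lia.
  rewrite -normE barM barV mulrACA -invfM Nyy mulNr divff //.
have -> : anti4 (y / y') 1 = scale4 y'^-1 (kframe s t X).
  by rewrite fr' /scale4 /anti4 /= mulr0 mulVf // mulrC.
by apply: krel_frame; rewrite ?invr_eq0.
Qed.

Lemma krel_Sec (i : F) X Y : i ^+ 2 = -1 -> inSec i X -> inSec i Y -> krel X Y.
Proof.
move=> i2 /(krel_Sec_diag i2)[z [z0 zm Xz]] /(krel_Sec_diag i2)[z' [z0' zm' Yz]].
have [|a a0 az] := @ratio_solve m.+1 m z z' _ z0 z0' zm zm'; first by rewrite card_pred; clear; lia.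
apply: (krel_trans Xz); apply: krel_trans (krel_sym Yz).
case: az => <-; first exact: krel_diag.
by apply: krel_trans (krel_diag _ a0); apply: krel_diag_swap.
Qed.

Lemma krel_Ext (i : F) X Y : i ^+ 2 = -1 -> inExt i X -> inExt i Y -> krel X Y.
Proof.
move=> i2 /(krel_Ext_anti i2)[z [z0 zm Xz]] /(krel_Ext_anti i2)[z' [z0' zm' Yz]].
have [|a a0 az] := @ratio_solve m m.+1 z z' _ z0 z0' zm zm'; first by rewrite card_pred; clear; lia.
apply: (krel_trans Xz); apply: krel_trans (krel_sym Yz).
case: az => <-; first exact: krel_anti.
by apply: krel_trans (krel_anti _ a0); apply: krel_anti_swap.
Qed.

(** Here i + 1/i = 0, so both types require herm = 0. Their quadratic characters i^(q+1) and i^(q-1)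
    are opposite signs, and a nonzero [quad X] has exactly one of them. *)
Lemma herm0_class (i : F) X : i ^+ 2 = -1 -> X != 0 ->
  ~~ isO X && (herm q X == 0) = inSec i X || inExt i X.
Proof.
move=> i2 X0; have i0 : i != 0 by rewrite -sqrf_eq0 i2 oppr_eq0 oner_eq0.
have iV : i^-1 = - i by apply: (mulfI i0); rewrite divff // mulrN -expr2 i2 opprK.
rewrite /isO /inSec /inExt X0 iV subrr mul0r -andb_orl /=.
have [H0|_] := eqVneq (herm q X) 0; last by rewrite !andbF.
rewrite !andbT; apply/idP/orP => [Q0|]; last first.
  by case=> /class_neq0; apply; rewrite expf_neq0.
have : (quad X ^+ halfexp) ^+ 2 = 1.
  rewrite -exprM mulnC halfexp_mul; apply: (mulfI Q0).
  by rewrite -exprS prednK ?expf_card ?mulr1 // ltnW // finNzRing_gt1.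
rewrite (_ : i ^+ q.+1 = - i ^+ m.*2); last by rewrite -addn2 exprD i2 mulrN1.
have i4 : (i ^+ m.*2) ^+ 2 = 1 by rewrite -exprM mulnC exprM i2 -signr_odd odd_double.
by move=> E; apply/orP; rewrite orbC -eqf_sqr E i4.
Qed.

(** * The Hermitian surface, its orbits and the surfaces S_j and E_k as loci *)

Lemma Herm_locus : Herm F q = locus (fun X => herm q X == 0).
Proof. by rewrite /Herm zero_locusE; apply: eq_locus => X _; rewrite Hform_c4. Qed.

Lemma Oset_locus : Oset F q = locus isO.
Proof.
have O1 y : isO ((1, y), (bar y, N y)).
  rewrite /isO /quad /herm /= !xpair_eqE oner_eq0 bar1 barK bar_norm !mul1r.
  by apply/and3P; split=> //; apply/eqP; ring.
have O0 : isO ((0, 0), (0, 1) : T2).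
  by rewrite /isO /quad /herm /= !xpair_eqE oner_eq0 !eqxx bar0 !(mul0r, mulr0, addr0, subr0) !eqxx.
apply/setP => P; rewrite inE; apply/orP/imsetP => [[|]|[X]].
- by rewrite inE => /eqP->; exists ((0, 0), (0, 1)) => //; rewrite inE O0 andbT; case/andP: O0.
- case/imsetP => y _ ->; exists ((1, y), (bar y, N y)); last by rewrite /c4 /= normE.
  by rewrite inE O1 andbT; case/andP: (O1 y).
rewrite inE => /andP[X0 /and3P[_ /eqP Q /eqP H]] ->.
have := quad_herm0 Q H; case: ifP => [x0|/negbT/negPn/eqP x0] E; [right | left].
  pose y := X.1.2 / X.1.1; apply/imsetP; exists y => //.
  have -> : X = scale4 X.1.1 ((1, y), (bar y, N y)).
    by rewrite {1}E /scale4 /= mulr1 [in RHS]mulrC divfK.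
  by rewrite pt_scale // /c4 /= normE.
have x0' : X.2.2 != 0 by apply: contra X0 => /eqP x0'; rewrite E x0' !xpair_eqE !eqxx.
have -> : X = scale4 X.2.2 ((0, 0), (0, 1)) by rewrite {1}E /scale4 /= !mulr0 mulr1.
by rewrite inE pt_scale.
Qed.

Lemma Herm_setD_Oset (i : F) : i ^+ 2 = -1 ->
  Herm F q :\: Oset F q = locus (fun X => inSec i X || inExt i X).
Proof.
move=> i2; rewrite Herm_locus Oset_locus locusD; last exact: isO_inv.
by apply: eq_locus => X X0; rewrite (herm0_class i2).
Qed.

Section ImaginaryUnit.

Variable i : F.
Hypothesis i2 : i ^+ 2 = -1.

Lemma i_sec : i ^+ (2 * q.+1) = 1.
Proof. by rewrite exprM i2 -signr_odd /= odd_double. Qed.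

Lemma i_ext : i ^+ (2 * m.*2) = 1.
Proof. by rewrite exprM i2 -signr_odd odd_double. Qed.

Lemma i_sqr_neq1 : i ^+ 2 != 1.
Proof. by rewrite i2 neg_neq // oner_eq0. Qed.

Lemma i_neq0 : i != 0.
Proof. by rewrite -sqrf_eq0 i2 oppr_eq0 oner_eq0. Qed.

Lemma card_locus_Sec : #|locus (inSec i)| = (m * n * n.+1)%N.
Proof.
have r0 : (0 < r)%N by rewrite !muln_gt0 m_gt0.
apply/eqP; rewrite -(eqn_pmul2l r0) card_locus; last exact: inSec_inv.
apply/eqP; transitivity (\sum_X (inSec i X)%R)%N.
  apply: eq_bigr => X _; have [S|S] := boolP (inSec i X); last by rewrite andbF.
  by rewrite (inSec_neq0 i_neq0 S).
by rewrite (card_inSec i_sec i_sqr_neq1); lia.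
Qed.

Lemma card_locus_Ext : #|locus (inExt i)| = (m.+1 * n * n.+1)%N.
Proof.
have r0 : (0 < r)%N by rewrite !muln_gt0 m_gt0.
apply/eqP; rewrite -(eqn_pmul2l r0) card_locus; last exact: inExt_inv.
apply/eqP; transitivity (\sum_X (inExt i X)%R)%N.
  apply: eq_bigr => X _; have [S|S] := boolP (inExt i X); last by rewrite andbF.
  by rewrite (inExt_neq0 i_neq0 S).
by rewrite (card_inExt i_ext i_sqr_neq1); lia.
Qed.

Lemma Korbit_Sec X : inSec i X -> Korbit q (pt (c4 X)) = locus (inSec i).
Proof.
move=> SX; apply/eqP; rewrite eqEsubset; apply/andP; split.
  apply: Korbit_inv => //; [exact: inSec_inv | | exact: (inSec_neq0 i_neq0)].
  by move=> s' s Y d; rewrite /inSec quad_kframe // herm_kframe.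
apply/subsetP => P /imsetP[Y]; rewrite inE => /andP[_ SY] ->.
exact: (krel_Sec i2).
Qed.

Lemma Korbit_Ext X : inExt i X -> Korbit q (pt (c4 X)) = locus (inExt i).
Proof.
move=> SX; apply/eqP; rewrite eqEsubset; apply/andP; split.
  apply: Korbit_inv => //; [exact: inExt_inv | | exact: (inExt_neq0 i_neq0)].
  by move=> s' s Y d; rewrite /inExt quad_kframe // herm_kframe.
apply/subsetP => P /imsetP[Y]; rewrite inE => /andP[_ SY] ->.
exact: (krel_Ext i2).
Qed.

Lemma Korbits_Herm B : (B \in Korbits q (Herm F q :\: Oset F q))
  = (B == locus (inSec i)) || (B == locus (inExt i)).
Proof.
rewrite /Korbits (Herm_setD_Oset i2); apply/imsetP/orP => [[P /imsetP[X]]|].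
  rewrite inE => /andP[X0 /orP[S|S]] -> ->.
    by left; rewrite Korbit_Sec.
  by right; rewrite Korbit_Ext.
case=> /eqP->.
  have /card_gt0P[P /imsetP[X]] : (0 < #|locus (inSec i)|)%N.
    by rewrite card_locus_Sec !muln_gt0 m_gt0.
  rewrite inE => /andP[X0 S] _; exists (pt (c4 X)); last by rewrite Korbit_Sec.
  by apply: imset_f; rewrite inE X0 S.
have /card_gt0P[P /imsetP[X]] : (0 < #|locus (inExt i)|)%N by rewrite card_locus_Ext.
rewrite inE => /andP[X0 S] _; exists (pt (c4 X)); last by rewrite Korbit_Ext.
by apply: imset_f; rewrite inE X0 S orbT.
Qed.

Lemma locus_Sec_Ext_card : #|locus (inSec i)| <> #|locus (inExt i)|.
Proof. by rewrite card_locus_Sec card_locus_Ext; nia. Qed.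

Lemma H1_locus : H1 F q = locus (inSec i).
Proof.
have n1 : ((n * (n + 1) * (q - 1))./2 = #|locus (inSec i)|)%N.
  rewrite card_locus_Sec -[RHS]doubleK; congr _./2.
  by clear; lia.
(* The two orbits have different sizes, so [pick] has a single candidate and the default value is
   never returned. *)
rewrite /H1 /Horbit_of_size n1; case: pickP => [B|none] /=.
  by rewrite Korbits_Herm => /andP[/orP[]/eqP-> // /eqP /esym /locus_Sec_Ext_card].
by have := none (locus (inSec i)); rewrite Korbits_Herm !eqxx.
Qed.

Lemma H2_locus : H2 F q = locus (inExt i).
Proof.
have n2 : ((n * (n + 1) * (q + 1))./2 = #|locus (inExt i)|)%N.
  rewrite card_locus_Ext -[RHS]doubleK; congr _./2.
  by clear; lia.
rewrite /H2 /Horbit_of_size n2; case: pickP => [B|none] /=.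
  by rewrite Korbits_Herm => /andP[/orP[]/eqP-> // /eqP /locus_Sec_Ext_card].
by have := none (locus (inExt i)); rewrite Korbits_Herm !eqxx orbT.
Qed.

End ImaginaryUnit.

(** [form_locus] needs the conjugate of gamma = w + 1/w to be a sign times gamma. Here [bar w] is
    w^(q+1)/w with w^(q+1) a sign; for E_k it is w^(q-1) w with w^(q-1) a sign. The condition on w^2
    says that gamma is not 0. *)
Lemma Sj_locus (xi : F) (j : nat) (w := xi ^+ (j * m)) :
  w ^+ (2 * q.+1) = 1 -> w ^+ 2 != -1 ->
  Sj q xi j = locus (fun X => isO X || inSec w X).
Proof.
move=> w1 w2; have w0 : w != 0 by apply: expf1_neq0 w1.
rewrite /Sj zero_locusE /= doubleK -/w; apply: eq_locus => X X0.
rewrite Fform_c4 subr_eq0 /inSec.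
have a2 : (w ^+ q.+1) ^+ 2 = 1 by rewrite -exprM mulnC.
apply: (form_locus X0 _ a2).
  have bw : bar w = w ^+ q.+1 * w^-1 by rewrite /frob [in RHS]exprSr mulfK.
  have aV : (w ^+ q.+1)^-1 = w ^+ q.+1.
    have a0 := expf_neq0 q.+1 w0; apply: (mulfI a0).
    by rewrite divff // -expr2.
  by rewrite barD barV bw invfM invrK aV mulrDr addrC.
apply: contra w2 => /eqP E; rewrite -subr_eq0 opprK.
apply/eqP; transitivity (w * (w + w^-1)); last by rewrite E mulr0.
by rewrite mulrDr divff.
Qed.

Lemma Ek_locus (xi : F) (k : nat) (w := xi ^+ (k * m.+1)) :
  w ^+ (2 * m.*2) = 1 -> w ^+ 2 != -1 ->
  Ek q xi k = locus (fun X => isO X || inExt w X).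
Proof.
move=> w1 w2; have w0 : w != 0.
  by apply: expf1_neq0 w1; rewrite muln_gt0 double_gt0 m_gt0.
rewrite /Ek zero_locusE (_ : (q.+1)./2 = m.+1) ?doubleK //= ?doubleK // -/w; apply: eq_locus => X X0.
rewrite Fform_c4 subr_eq0 /inExt.
have a2 : (w ^+ m.*2) ^+ 2 = 1 by rewrite -exprM mulnC.
apply: (form_locus X0 _ a2).
  have bw : bar w = w ^+ m.*2 * w by rewrite /frob exprSr.
  have aV : (w ^+ m.*2)^-1 = w ^+ m.*2.
    have a0 := expf_neq0 m.*2 w0; apply: (mulfI a0).
    by rewrite divff // -expr2.
  by rewrite barD barV bw invfM aV mulrDr.
apply: contra w2 => /eqP E; rewrite -subr_eq0 opprK.
apply/eqP; transitivity (w * (w + w^-1)); last by rewrite E mulr0.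
by rewrite mulrDr divff.
Qed.

End Surface.

(** * The roots of unity attached to j and k *)

Lemma dvdn_lt_double (a b c : nat) :
  (a * b %| c * b)%N -> (0 < b)%N -> (0 < c < 2 * a)%N -> c = a.
Proof.
move=> /[swap] b0; rewrite dvdn_pmul2r // => /dvdnP[[|[|d]] ->] /andP[c0 ca] //.
  by rewrite mul1n.
by move: ca; rewrite !mulSn mul0n; lia.
Qed.

Theorem theorem2p29 (p e q : nat) (hp : prime p) (he : (0 < e)%N)
    (hq : q = (p ^ e)%N) (q_odd : odd q)
    (F : finFieldType) (hF : #|F| = (q ^ 2)%N)
    (xi : F) (hxi : (q ^ 2 - 1)%N.-primitive_root xi)
    (j : nat) (hj : (1 <= j <= q)%N) (hj' : j <> (q.+1)./2)
    (k : nat) (hk : (1 <= k <= q - 2)%N) (hk' : k <> (q.-1)./2) :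
  [/\ quasi_Hermitian q (Sj q xi j :|: Ek q xi k),
      quasi_Hermitian q (H1 F q :|: Ek q xi k)
    & quasi_Hermitian q (Sj q xi j :|: H2 F q)].
Proof.
have frobD (x y : F) : (x + y) ^+ q = x ^+ q + y ^+ q.
  have cF : p \in [pchar F] by apply: (card_finPcharP (n := (e * 2)%N)) => //; rewrite hF hq expnM.
  by rewrite exprDn_pchar // hq pnatX pnatE // cF.
pose m := q./2; have qE : q = m.*2.+1 by rewrite -[LHS]odd_double_half q_odd.
clearbody m; clear hp he hq q_odd; subst q.
have cE : (m.*2.+1 ^ 2 - 1 = 4 * (m * m.+1))%N by lia.
rewrite cE in hxi.
have m0 : (0 < m)%N := m_gt0 hF.
have xi_eq1 c : (xi ^+ c == 1) = (4 * (m * m.+1) %| c)%N by rewrite -(prim_order_dvd hxi).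
(* The exponent of [i] is (q^2-1)/4, so that i has order 4 and i^2 = -1. *)
pose w := xi ^+ (j * m); pose v := xi ^+ (k * m.+1); pose i := xi ^+ (m * m.+1).
have w1 : w ^+ (2 * m.*2.+2) = 1.
  by apply/eqP; rewrite -exprM xi_eq1; apply/dvdnP; exists j; lia.
have v1 : v ^+ (2 * m.*2) = 1.
  by apply/eqP; rewrite -exprM xi_eq1; apply/dvdnP; exists k; lia.
have sq (x : F) : x ^+ 2 = -1 -> x ^+ 4 = 1 by move=> x2; rewrite (exprM x 2 2) x2 sqrrN expr1n.
have i2 : i ^+ 2 = -1.
  have : (i ^+ 2) ^+ 2 == 1 by rewrite -!exprM xi_eq1; apply/dvdnP; exists 1%N; lia.
  rewrite sqrf_eq1 => /orP[|/eqP//]; rewrite -exprM xi_eq1.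
  by rewrite gtnNdvd // ?muln_gt0 ?m0 //; nia.
have hj2 : j <> m.+1 by rewrite /= doubleK in hj'.
have hk2 : k <> m by rewrite /= doubleK in hk'.
(* w^2 = 1 requires q+1 to divide j, and v^2 = 1 requires q-1 to divide k, both impossible in the
   given ranges. The values -1 would require j = (q+1)/2 and k = (q-1)/2, the excluded indices. *)
have w2 : w ^+ 2 != 1.
  apply/negP; rewrite -exprM xi_eq1.
  have -> : (4 * (m * m.+1) = (2 * m.+1) * (2 * m))%N by ring.
  have -> : (j * m * 2 = j * (2 * m))%N by ring.
  by move/dvdn_lt_double; move: hj m0; clear; lia.
have v2 : v ^+ 2 != 1.
  apply/negP; rewrite -exprM xi_eq1.
  have -> : (4 * (m * m.+1) = (2 * m) * (2 * m.+1))%N by ring.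
  have -> : (k * m.+1 * 2 = k * (2 * m.+1))%N by ring.
  by move/dvdn_lt_double; move: hk m0; clear; lia.
have w3 : w ^+ 2 != -1.
  apply/eqP => /sq/eqP; rewrite -exprM xi_eq1.
  have -> : (4 * (m * m.+1) = m.+1 * (4 * m))%N by ring.
  have -> : (j * m * 4 = j * (4 * m))%N by ring.
  by move/dvdn_lt_double; move: hj hj2 m0; clear; lia.
have v3 : v ^+ 2 != -1.
  apply/eqP => /sq/eqP; rewrite -exprM xi_eq1.
  have -> : (4 * (m * m.+1) = m * (4 * m.+1))%N by ring.
  have -> : (k * m.+1 * 4 = k * (4 * m.+1))%N by ring.
  by move/dvdn_lt_double; move: hk hk2 m0; clear; lia.
rewrite (Sj_locus hF frobD w1 w3) (Ek_locus hF frobD v1 v3).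
rewrite (H1_locus hF frobD i2) (H2_locus hF frobD i2) !locusU.
have T (a b : F) D : a ^+ (2 * m.*2.+2) = 1 -> a ^+ 2 != 1 -> b ^+ (2 * m.*2) = 1 -> b ^+ 2 != 1 ->
    (forall X, D X = inT m a b X) -> quasi_Hermitian m.*2.+1 (locus D).
  move=> a1 a2 b1 b2 DE; rewrite (eq_locus (fun X _ => DE X)).
  exact: (quasi_Hermitian_locus hF frobD).
have is1 := i_sec m i2; have ie1 := i_ext m i2; have in1 := i_sqr_neq1 hF i2.
(* H_1 and H_2 are the types with w = i that do not contain O; in each union O is supplied by S_j or
   E_k. *)
split.
- apply: (T w v) => // X; rewrite /inT.
  by case: (isO m X) (inSec m w X) => [] [] //=; rewrite ?orbT.
- apply: (T i v) => // X; rewrite /inT.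
  by case: (isO m X) (inSec m i X) => [] [].
- by apply: (T w i) => // X; rewrite /inT orbA.
Qed.
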